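(* Let $H$ be a compact quantum group with antipode $S$, positive antipode $S_+$, normal integral $\varphi$ and modular function $\alpha$. Then the linear functional $\beta:H\to\mathbb{C}$ satisfying $S_+=(\beta\star\mathrm{id})(\mathrm{id}\star\beta^{-1})$, $S^2=(\beta^2\star\mathrm{id})(\mathrm{id}\star\beta^{-2})$, and the properties (i) $\beta=\beta S_+$, $\beta^{-1}=\beta^{-1}S_+$; (ii) $\beta(x)=\overline{\beta(x^\circ)}$ for all $x\in H$; (iii) $\beta\star\mathrm{id}$ and $\mathrm{id}\star\beta^{-1}$ are selfadjoint, commute with each other and leave invariant the simple components $H_\rho$ of $H$; (iv) $\beta\star\mathrm{id}$ and $\mathrm{id}\star\beta^{-1}$ are positive; can be taken also to be an algebra morphism that satisfies $\beta^4=\alpha$.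
   Context: Everything is over $\mathbb{C}$. A $\circ$-structure on a coalgebra is a conjugate linear involution $c\mapsto c^\circ$ with $\Delta(c^\circ)=\sum c_2^\circ\otimes c_1^\circ$. A $\circ$-Hopf algebra is a Hopf algebra $H$ with a $\circ$-structure on its coalgebra such that $(xy)^\circ=x^\circ y^\circ$. A unitary inner product on a right $H$-comodule $V$ (coaction $v\mapsto\sum v_0\otimes v_1$) is an inner product (linear in the first, conjugate linear in the second variable) with $\sum\langle u_0,v\rangle u_1=\sum\langle u,v_0\rangle v_1^\circ$ for all $u,v$. A compact quantum group is a $\circ$-Hopf algebra such that every right $H$-comodule admits a unitary inner product. Such an $H$ is cosemisimple: $H=\bigoplus_{\rho}H_\rho$ with $H_\rho$ the simple subcoalgebras (simple components); the normal integral $\varphi:H\to\mathbb{C}$ is the projection onto the component $\mathbb{C}1\cong\mathbb{C}$. The form $\langle x,y\rangle=\varphi(S(y^\circ)x)$ is an inner product on $H$; selfadjointness and positivity of operators refer to it, an operator $L$ being positive if it is selfadjoint and $\langle L(x),x\rangle>0$ for all $x\ne0$. The operator $S^2$ is positive, and the positive antipode $S_+$ is the unique positive automorphism of algebras and coalgebras of $H$ with $S_+^2=S^2$. For $\tau\in H^*$: $(\tau\star\mathrm{id})(x)=\sum\tau(x_1)x_2$ and $(\mathrm{id}\star\tau)(x)=\sum x_1\tau(x_2)$; powers and inverses of functionals are for the convolution product of $H^*$. The Nakayama automorphism $\mathcal{N}$ is the algebra automorphism of $H$ characterized by $\varphi(xy)=\varphi(y\,\mathcal{N}(x))$ for all $x,y$,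 and the modular function is $\alpha=\varepsilon\mathcal{N}$. *)

(* Defs.v *)
From HB Require Import structures.
From mathcomp Require Import all_boot all_order all_algebra.
From mathcomp Require Import complex.
From mathcomp Require Import boolp reals.

Set Implicit Arguments.
Unset Strict Implicit.
Unset Printing Implicit Defensive.

Import GRing.Theory Num.Theory.
Local Open Scope ring_scope.
Local Open Scope quotient_scope.

Declare Scope tensor_scope.
Delimit Scope tensor_scope with tensor.
Local Open Scope tensor_scope.

Reserved Notation "v \ox w" (at level 40, left associativity).

(* Formal sums of pairs (v, w), as sequences, modulo having the same image
   under every balanced map into an abelian group. *)
Section Tensor.
Variables (K : comNzRingType) (V W : lmodType K).

Definition balanced (G : zmodType) (f : V -> W -> G) : Prop :=
  [/\ forall w, {morph f^~ w : u v / u + v},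
      forall v, {morph f v : u w / u + w}
    & forall a v w, f (a *: v) w = f v (a *: w)].

Definition formal_sum (G : zmodType) (f : V -> W -> G) (s : seq (V * W)) : G :=
  \sum_(p <- s) f p.1 p.2.

Definition tensor_eqv (s t : seq (V * W)) : bool :=
  `[< forall (G : zmodType) (f : V -> W -> G),
        balanced f -> formal_sum f s = formal_sum f t >].

Lemma tensor_eqvP s t :
  reflect (forall (G : zmodType) (f : V -> W -> G),
             balanced f -> formal_sum f s = formal_sum f t)
          (tensor_eqv s t).
Proof. exact: asboolP. Qed.

Lemma tensor_eqv_refl : reflexive tensor_eqv.
Proof. by move=> s; apply/tensor_eqvP. Qed.

Lemma tensor_eqv_sym : symmetric tensor_eqv.
Proof.
by move=> s t; apply/tensor_eqvP/tensor_eqvP => st G f fB; rewrite st.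
Qed.

Lemma tensor_eqv_trans : transitive tensor_eqv.
Proof.
move=> t s u /tensor_eqvP st /tensor_eqvP tu; apply/tensor_eqvP => G f fB.
by rewrite st // tu.
Qed.

Canonical tensor_equiv_rel :=
  EquivRel tensor_eqv tensor_eqv_refl tensor_eqv_sym tensor_eqv_trans.

Definition tensor : Type := {eq_quot tensor_equiv_rel}.

HB.instance Definition _ := Choice.on tensor.
HB.instance Definition _ := EqQuotient.on tensor.

Definition tens (v : V) (w : W) : tensor := \pi_tensor [:: (v, w)].

(* The additive map on the tensor product induced by f; it only makes sense
   for balanced f, and includes the conjugate bilinear ones. *)
Definition tensor_lift (G : zmodType) (f : V -> W -> G) (t : tensor) : G :=
  formal_sum f (repr t).

Lemma tensor_lift_pi (G : zmodType) (f : V -> W -> G) s :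
  balanced f -> tensor_lift f (\pi_tensor s) = formal_sum f s.
Proof.
move=> fB; have /eqmodP/tensor_eqvP : repr (\pi_tensor s) = s %[mod tensor].
  by rewrite reprK.
exact.
Qed.

Lemma tensorP (t u : tensor) :
  (forall (G : zmodType) (f : V -> W -> G),
     balanced f -> tensor_lift f t = tensor_lift f u) -> t = u.
Proof.
by move=> tu; rewrite -[t]reprK -[u]reprK; apply/eqmodP/tensor_eqvP.
Qed.

Let scale_formal (a : K) (s : seq (V * W)) := [seq (a *: p.1, p.2) | p <- s].

Definition tensor_zero : tensor := \pi_tensor [::].
Definition tensor_add (t u : tensor) : tensor := \pi_tensor (repr t ++ repr u).
Definition tensor_scale (a : K) (t : tensor) : tensor :=
  \pi_tensor (scale_formal a (repr t)).
Definition tensor_opp (t : tensor) : tensor := tensor_scale (-1) t.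

Let balanced_scale (G : zmodType) (f : V -> W -> G) a :
  balanced f -> balanced (fun v w => f (a *: v) w).
Proof.
case=> fl fr fZ; split=> [w u v|v u w|b v w]; rewrite ?scalerDr ?fl ?fr //.
by rewrite scalerA mulrC -scalerA fZ.
Qed.

Let lift0 (G : zmodType) (f : V -> W -> G) :
  balanced f -> tensor_lift f tensor_zero = 0.
Proof. by move=> fB; rewrite tensor_lift_pi // /formal_sum big_nil. Qed.

Let liftD (G : zmodType) (f : V -> W -> G) t u : balanced f ->
  tensor_lift f (tensor_add t u) = tensor_lift f t + tensor_lift f u.
Proof. by move=> fB; rewrite tensor_lift_pi // /formal_sum big_cat. Qed.

Let liftZ (G : zmodType) (f : V -> W -> G) a t : balanced f ->
  tensor_lift f (tensor_scale a t) = tensor_lift (fun v w => f (a *: v) w) t.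
Proof. by move=> fB; rewrite tensor_lift_pi // /formal_sum big_map. Qed.

Let liftE (G : zmodType) (f : V -> W -> G) t :
  tensor_lift f t = \sum_(p <- repr t) f p.1 p.2.
Proof. by []. Qed.

Fact tensor_addA : associative tensor_add.
Proof. by move=> t u w; apply: tensorP => G f fB; rewrite !liftD // addrA. Qed.

Fact tensor_addC : commutative tensor_add.
Proof. by move=> t u; apply: tensorP => G f fB; rewrite !liftD // addrC. Qed.

Fact tensor_add0 : left_id tensor_zero tensor_add.
Proof. by move=> t; apply: tensorP => G f fB; rewrite liftD // lift0 // add0r. Qed.

Fact tensor_addN : left_inverse tensor_zero tensor_opp tensor_add.
Proof.
move=> t; apply: tensorP => G f fB; rewrite liftD // lift0 // liftZ //.
rewrite !liftE -big_split big1 // => p _ /=; case: (fB) => fl _ _.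
apply: (addIr (f p.1 p.2)).
by rewrite add0r -addrA -[in X in _ + X = _]fl -fl scaleN1r addKr.
Qed.

HB.instance Definition _ := GRing.isZmodule.Build tensor
  tensor_addA tensor_addC tensor_add0 tensor_addN.

Fact tensor_scaleA a b t :
  tensor_scale a (tensor_scale b t) = tensor_scale (a * b) t.
Proof.
apply: tensorP => G f fB; rewrite !liftZ //; last exact: balanced_scale.
by rewrite !liftE; apply: eq_bigr => p _; rewrite scalerA.
Qed.

Fact tensor_scale1 : left_id 1 tensor_scale.
Proof.
move=> t; apply: tensorP => G f fB; rewrite liftZ // !liftE.
by apply: eq_bigr => p _; rewrite scale1r.
Qed.

Fact tensor_scaleDr : right_distributive tensor_scale +%R.
Proof.
move=> a t u; apply: tensorP => G f fB; rewrite liftD // !liftZ //.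
by apply: liftD; exact: balanced_scale.
Qed.

Fact tensor_scaleDl t : {morph tensor_scale^~ t : a b / a + b}.
Proof.
move=> a b; apply: tensorP => G f fB; rewrite liftD // !liftZ //.
rewrite !liftE -big_split; apply: eq_bigr => p _ /=.
by case: fB => fl _ _; rewrite scalerDl fl.
Qed.

HB.instance Definition _ := GRing.Zmodule_isLmodule.Build K tensor
  tensor_scaleA tensor_scale1 tensor_scaleDr tensor_scaleDl.

Lemma tensor_lift_tens (G : zmodType) (f : V -> W -> G) v w :
  balanced f -> tensor_lift f (tens v w) = f v w.
Proof. by move=> fB; rewrite tensor_lift_pi // /formal_sum big_seq1. Qed.

Lemma tensor_liftD (G : zmodType) (f : V -> W -> G) : balanced f ->
  {morph tensor_lift f : t u / t + u}.
Proof. by move=> fB t u; apply: liftD. Qed.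

Lemma tensor_liftZ (U : lmodType K) (f : V -> W -> U) a t :
  balanced f -> (forall v w, f (a *: v) w = a *: f v w) ->
  tensor_lift f (a *: t) = a *: tensor_lift f t.
Proof.
move=> fB fZ; rewrite liftZ // !liftE scaler_sumr.
by apply: eq_bigr => p _; rewrite fZ.
Qed.

Lemma balanced_tens : balanced tens.
Proof.
split=> [w u v|v u w|a v w]; apply: tensorP => G f fB.
- by rewrite liftD // !tensor_lift_tens //; case: fB => fl _ _; rewrite fl.
- by rewrite liftD // !tensor_lift_tens //; case: fB => _ fr _; rewrite fr.
- by rewrite !tensor_lift_tens //; case: fB => _ _ ->.
Qed.

Lemma tens_scalel a v w : tens (a *: v) w = a *: tens v w.
Proof.
apply: tensorP => G f fB.
by rewrite liftZ // !tensor_lift_tens //; exact: balanced_scale.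
Qed.

Lemma tensor_repr (t : tensor) : t = \sum_(p <- repr t) tens p.1 p.2.
Proof.
apply: tensorP => G f fB.
rewrite (big_morph (tensor_lift f) (tensor_liftD fB) (lift0 fB)).
by rewrite liftE; apply: eq_bigr => p _; rewrite tensor_lift_tens.
Qed.

End Tensor.

Notation "v \ox w" := (tens v w) : tensor_scope.

Definition tensor_map (K : comNzRingType) (V W V' W' : lmodType K)
    (f : V -> V') (g : W -> W') : tensor V W -> tensor V' W' :=
  tensor_lift (fun v w => f v \ox g w).

Definition tensor_assoc (K : comNzRingType) (U V W : lmodType K) :
    tensor (tensor U V) W -> tensor U (tensor V W) :=
  tensor_lift (fun t w => tensor_lift (fun u v => u \ox (v \ox w)) t).

HB.mixin Record isCoalgebra (K : comNzRingType) V of GRing.Lmodule K V := {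
  comul : {linear V -> tensor V V};
  counit : {scalar V};
  comulA : forall x : V,
    tensor_assoc (tensor_map comul id (comul x))
    = tensor_map id comul (comul x);
  counitl : forall x : V,
    tensor_lift (fun a b => counit a *: b) (comul x) = x;
  counitr : forall x : V,
    tensor_lift (fun a b => counit b *: a) (comul x) = x
}.

#[short(type="coalgType")]
HB.structure Definition Coalgebra (K : comNzRingType) :=
  { V of GRing.Lmodule K V & isCoalgebra K V }.

HB.mixin Record isHopfAlgebra (K : comNzRingType) H
    of GRing.Algebra K H & Coalgebra K H := {
  comulM : forall x y : H,
    comul (x * y)
    = tensor_lift (fun a b =>
        tensor_lift (fun c d => (a * c) \ox (b * d)) (comul y)) (comul x);
  comul1 : comul (1 : H) = 1 \ox 1;
  counitM : {morph (counit : H -> K) : x y / x * y};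
  counit1 : counit (1 : H) = 1;
  antipode : {linear H -> H};
  antipodel : forall x : H,
    tensor_lift (fun a b => antipode a * b) (comul x) = (counit x)%:A;
  antipoder : forall x : H,
    tensor_lift (fun a b => a * antipode b) (comul x) = (counit x)%:A
}.

#[short(type="hopfAlgType")]
HB.structure Definition HopfAlgebra (K : comNzRingType) :=
  { H of GRing.Algebra K H & Coalgebra K H & isHopfAlgebra K H }.

HB.mixin Record hasCirc (C : numClosedFieldType) V of Coalgebra C V := {
  circ : {linear V -> V | Num.conj \; *:%R};
  circK : involutive circ;
  comul_circ : forall x : V,
    comul (circ x) = tensor_lift (fun a b => circ b \ox circ a) (comul x)
}.

#[short(type="circCoalgType")]
HB.structure Definition CircCoalgebra (C : numClosedFieldType) :=
  { V of Coalgebra C V & hasCirc C V }.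

HB.mixin Record isCircHopfAlgebra (C : numClosedFieldType) H
    of HopfAlgebra C H & CircCoalgebra C H := {
  circM : {morph (circ : H -> H) : x y / x * y}
}.

#[short(type="circHopfAlgType")]
HB.structure Definition CircHopfAlgebra (C : numClosedFieldType) :=
  { H of HopfAlgebra C H & CircCoalgebra C H & isCircHopfAlgebra C H }.

Definition right_comodule (K : comNzRingType) (H : coalgType K)
    (V : lmodType K) (rho : {linear V -> tensor V H}) : Prop :=
  (forall v, tensor_assoc (tensor_map rho id (rho v))
             = tensor_map id comul (rho v)) /\
  (forall v, tensor_lift (fun v0 v1 => counit v1 *: v0) (rho v) = v).

Definition unitary_inner_product (C : numClosedFieldType)
    (H : circCoalgType C) (V : lmodType C) (rho : {linear V -> tensor V H})
    (form : {dot V for (@Num.conj C)}) : Prop :=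
  forall u v : V,
    tensor_lift (fun u0 u1 => form u0 v *: u1) (rho u)
    = tensor_lift (fun v0 v1 => form u v0 *: circ v1) (rho v).

Definition compact_quantum_group (C : numClosedFieldType)
    (H : circHopfAlgType C) : Prop :=
  forall (V : lmodType C) (rho : {linear V -> tensor V H}),
    right_comodule rho ->
    exists form : {dot V for (@Num.conj C)}, unitary_inner_product rho form.

Section Subcoalgebras.
Variables (K : comNzRingType) (V : coalgType K).
Implicit Types D E : {pred V}.

Definition subcoalgebra D : Prop :=
  GRing.submod_closed D /\
  {in D, forall x, exists2 s : seq (V * V),
     all (fun p => (p.1 \in D) && (p.2 \in D)) s
     & comul x = \sum_(p <- s) p.1 \ox p.2}.

Definition simple_subcoalgebra D : Prop :=
  [/\ subcoalgebra D,
      exists2 x, x \in D & x != 0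
    & forall E, subcoalgebra E -> {subset E <= D} ->
        (exists2 x, x \in E & x != 0) -> {subset D <= E}].

End Subcoalgebras.

Section Convolution.
Variables (K : comNzRingType) (H : coalgType K).
Implicit Types s t : H -> K.

Definition conv s t (x : H) : K :=
  tensor_lift (fun a b => s a * t b) (comul x).

Definition convX s (n : nat) : H -> K := iter n (conv s) counit.

Definition conv_inverse s t : Prop :=
  conv s t =1 counit /\ conv t s =1 counit.

(* [convl t] is $t \star \mathrm{id}$ and [convr t] is $\mathrm{id} \star t$. *)
Definition convl t (x : H) : H :=
  tensor_lift (fun a b => t a *: b) (comul x).
Definition convr t (x : H) : H :=
  tensor_lift (fun a b => t b *: a) (comul x).

End Convolution.

(* The projection onto the line of scalars along the sum of the other simple
   subcoalgebras. *)
Definition normal_integral (K : comNzRingType) (H : hopfAlgType K)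
    (phi : {scalar H}) : Prop :=
  (forall a : K, phi a%:A = a) /\
  (forall D : {pred H}, simple_subcoalgebra D ->
     ~ (forall x, x \in D <-> exists a : K, x = a%:A) ->
     {in D, forall x, phi x = 0}).

Section Operators.
Variables (C : numClosedFieldType) (H : circHopfAlgType C) (phi : {scalar H}).
Implicit Types L : H -> H.

Definition inner_product (x y : H) : C := phi (antipode (circ y) * x).

Definition selfadjoint L : Prop :=
  forall x y, inner_product (L x) y = inner_product x (L y).

Definition positive L : Prop :=
  selfadjoint L /\ forall x, x != 0 -> 0 < inner_product (L x) x.

Definition coalgebra_morphism L : Prop :=
  (forall x, comul (L x) = tensor_map L L (comul x)) /\
  (forall x, counit (L x) = counit x).

Definition positive_antipode (Sp : {lrmorphism H -> H}) : Prop :=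
  [/\ bijective Sp, coalgebra_morphism Sp, positive Sp
    & forall x, Sp (Sp x) = antipode (antipode x)].

Definition nakayama_automorphism (N : {lrmorphism H -> H}) : Prop :=
  bijective N /\ forall x y, phi (x * y) = phi (y * N x).

Definition modular_function (N : {lrmorphism H -> H}) (x : H) : C :=
  counit (N x).

End Operators.

(* Main.v *)
Require Import Defs.
From HB Require Import structures.
From mathcomp Require Import all_boot all_order all_algebra.
From mathcomp Require Import complex.
From mathcomp Require Import boolp reals.

(* Write y^* for S(y°).  Compactness, applied to H as a comodule over itself,
   gives an inner product F for which every element of H is a combination of
   entries of unitary corepresentations u, i.e. with (u_ij)° = u_ji, and for
   which the orthogonal complement of a subcoalgebra is a subcoalgebra.  Hence
   H is the sum of its simple subcoalgebras, phi is a two-sided integral, and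
   <x, y> = phi(y^* x) is an inner product.

   Invariance of phi gives N = S^-2 (alpha ⋆ id) = S^2 (id ⋆ alpha), and
   <N x, x> = <x^*, x^* > > 0.  So A := alpha ⋆ id = S_+ N S_+ is a positive
   algebra automorphism; being locally finite, it is diagonalizable with
   positive eigenvalues.  The operator that multiplies the a-eigenvectors by
   a^(1/4) is multiplicative, because products of eigenvectors are
   eigenvectors, and it commutes with the operators id ⋆ f; hence it is
   beta ⋆ id for a character beta, and beta^4 = alpha.  Finally S_+ and
   (beta ⋆ id)(id ⋆ beta^-1) are commuting positive operators whose fourth
   powers both equal S^4, so they coincide. *)

Set Implicit Arguments.
Unset Strict Implicit.
Unset Printing Implicit Defensive.

Import Order.TTheory GRing.Theory Num.Theory.
Local Open Scope ring_scope.
Local Open Scope tensor_scope.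

(** * Inner products and functional calculus *)

(** The form [F] is compatible with the coaction on one side only and knows nothing of products. It
    supplies unitary corepresentations and cosemisimplicity, whereas positivity of
    [inner_product phi] is a separate statement about Gram matrices. The bridge from [phi] to
    everything else is strong invariance ([convl_mull], [convr_mull]). The root is taken of the
    operator [A] because positivity, and with it a spectral calculus, is available for operators;
    the functional is recovered afterwards by composing with the counit. Nothing similar is done for
    [id ⋆ beta^-1]. Its properties are carried over from [beta ⋆ id] by the antipode:
    [S (id ⋆ beta^-1) = (beta ⋆ id) S], and [S] is an isometry up to [A], [<S x, S y> = <A x, y>].
    In the final comparison, positive square roots are shown to be unique by a short algebraic
    argument for commuting operators, applied once to the squares and once to the operators
    themselves. *)

Lemma linear_dependence (K : fieldType) (V : lmodType K) (m n : nat)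
    (x : 'I_m -> V) (b : 'I_n -> V) (M : 'I_m -> 'I_n -> K) :
  (n < m)%N -> (forall i, x i = \sum_j M i j *: b j) ->
  exists2 r : 'I_m -> K, (exists i, r i != 0) & \sum_i r i *: x i = 0.
Proof.
move=> nm xE; pose A : 'M[K]_(m, n) := \matrix_(i, j) M i j.
have : kermx A != 0.
  rewrite -mxrank_eq0 mxrank_ker -lt0n subn_gt0.
  exact: leq_ltn_trans (rank_leq_col A) nm.
case/rowV0Pn => r /sub_kermxP rA r0; exists (fun i => r 0 i).
  case: (pickP (fun i => r 0 i != 0)) => [i ri|H]; first by exists i.
  by case/eqP: r0; apply/rowP => i; rewrite mxE; apply/eqP/negbFE; rewrite H.
under eq_bigr => i _ do rewrite xE scaler_sumr.
rewrite exchange_big big1 //= => j _.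
have /rowP/(_ j) := rA; rewrite !mxE => rAj.
transitivity ((\sum_i r 0 i * A i j) *: b j); last by rewrite rAj scale0r.
by rewrite scaler_suml; apply: eq_bigr => i _; rewrite scalerA mxE.
Qed.

Section InnerProduct.
Variables (C : numClosedFieldType) (V : lmodType C).
Implicit Types (f : V -> V -> C) (x y z : V).

(** A predicate on bare functions, so that one theory covers both the packaged form given by
    compactness and [inner_product phi], whose positivity is only proved much later. *)
Definition is_inner f : Prop :=
  [/\ forall z, scalar (f^~ z),
      forall x y, f y x = (f x y)^*
    & forall x, x != 0 -> 0 < f x x].

Lemma dot_is_inner (f : {dot V for (@Num.conj C)}) : is_inner f.
Proof.
split=> [z a x y|x y|x x0]; last exact: neq0_dnorm_gt0.
  by rewrite linearPl.
by rewrite [LHS]hermC expr0 mul1r.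
Qed.

Section Theory.
Variables (f : V -> V -> C) (fI : is_inner f).

Lemma innerDl x y z : f (x + y) z = f x z + f y z.
Proof. by case: fI => /(_ z 1 x y); rewrite scale1r mul1r. Qed.

Lemma inner0l z : f 0 z = 0.
Proof. by apply: (addIr (f 0 z)); rewrite -innerDl !add0r. Qed.

Lemma innerZl a x z : f (a *: x) z = a * f x z.
Proof. by case: fI => /(_ z a x 0); rewrite inner0l !addr0. Qed.

Lemma innerNl x z : f (- x) z = - f x z.
Proof. by rewrite -scaleN1r innerZl mulN1r. Qed.

Lemma innerC x y : f y x = (f x y)^*. Proof. by case: fI. Qed.

Lemma innerDr x y z : f z (x + y) = f z x + f z y.
Proof. by rewrite innerC innerDl rmorphD /= -!innerC. Qed.

Lemma innerZr a x z : f z (a *: x) = a^* * f z x.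
Proof. by rewrite innerC innerZl rmorphM /= -innerC. Qed.

Lemma inner0r z : f z 0 = 0.
Proof. by rewrite innerC inner0l rmorph0. Qed.

Lemma inner_suml (I : Type) (r : seq I) (P : pred I) (a : I -> C)
    (x : I -> V) z :
  f (\sum_(i <- r | P i) a i *: x i) z = \sum_(i <- r | P i) a i * f (x i) z.
Proof.
rewrite (big_morph (f^~ z) (fun x y => innerDl x y z) (inner0l z)).
by apply: eq_bigr => i _; rewrite innerZl.
Qed.

Lemma inner_sumr (I : Type) (r : seq I) (P : pred I) (a : I -> C)
    (x : I -> V) z :
  f z (\sum_(i <- r | P i) a i *: x i)
  = \sum_(i <- r | P i) (a i)^* * f z (x i).
Proof.
rewrite (big_morph (f z) (fun x y => innerDr x y z) (inner0r z)).
by apply: eq_bigr => i _; rewrite innerZr.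
Qed.

Lemma inner_gt0 x : x != 0 -> 0 < f x x. Proof. by case: fI => _ _; apply. Qed.

Lemma inner_eq0 x : f x x = 0 -> x = 0.
Proof. by move=> fx; apply/eqP; case: eqVneq => // /inner_gt0; rewrite fx ltxx. Qed.

Lemma inner_scalar z : scalar (f^~ z).
Proof. by case: fI. Qed.

Lemma inner_eq x y : (forall z, f x z = f y z) -> x = y.
Proof.
move=> xy; apply/eqP; rewrite -subr_eq0; apply/eqP/inner_eq0.
by rewrite innerDl innerNl xy subrr.
Qed.

Definition orthonormal_family n (e : 'I_n -> V) : Prop :=
  forall i j, f (e i) (e j) = (i == j)%:R.

(** For an orthonormal [e] this is membership in the span, with the coefficients already named. *)
Definition in_span_on n (e : 'I_n -> V) x : Prop :=
  x = \sum_i f x (e i) *: e i.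

Lemma sum_delta n (F : 'I_n -> C) (j : 'I_n) :
  \sum_i F i * (i == j)%:R = F j.
Proof.
rewrite (bigD1 j) //= eqxx mulr1 big1 ?addr0 // => i /negPf ->.
by rewrite mulr0.
Qed.

Lemma orthonormal_coef n (e : 'I_n -> V) (c : 'I_n -> C) j :
  orthonormal_family e -> f (\sum_i c i *: e i) (e j) = c j.
Proof.
move=> eON; rewrite inner_suml -[RHS](sum_delta c).
by apply: eq_bigr => i _; rewrite eON.
Qed.

Lemma in_span_comb n (e : 'I_n -> V) (c : 'I_n -> C) :
  orthonormal_family e -> in_span_on e (\sum_i c i *: e i).
Proof. by move=> eON; apply: eq_bigr => j _; rewrite orthonormal_coef. Qed.

Lemma in_spanP n (e : 'I_n -> V) : orthonormal_family e ->
  forall a x y, in_span_on e x -> in_span_on e y -> in_span_on e (a *: x + y).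
Proof.
move=> eON a x y xE yE; rewrite [in X in in_span_on _ X]xE.
rewrite [in X in in_span_on _ X]yE scaler_sumr -big_split /=.
under eq_bigr => i _ do rewrite scalerA -scalerDl.
exact: in_span_comb.
Qed.

Lemma residual_orth n (e : 'I_n -> V) x j : orthonormal_family e ->
  f (x - \sum_i f x (e i) *: e i) (e j) = 0.
Proof. by move=> eON; rewrite innerDl innerNl orthonormal_coef // subrr. Qed.

(** The two equations between [y] and [e' ord0] serve opposite purposes: one puts the new vector in
    every subspace containing [y], the other expands [y] in the new family. *)
Lemma orthonormal_extend n (e : 'I_n -> V) y :
  orthonormal_family e -> y != 0 -> (forall i, f y (e i) = 0) ->
  exists e' : 'I_n.+1 -> V,
    [/\ orthonormal_family e', exists2 c, e' ord0 = c *: y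
        & y = sqrtC (f y y) *: e' ord0
      & forall i, e' (lift ord0 i) = e i].
Proof.
move=> eON y0 ye; set c := sqrtC (f y y).
have fy := inner_gt0 y0; have c0 : 0 < c by rewrite sqrtC_gt0.
exists (fun i => oapp e (c^-1 *: y) (unlift ord0 i)); split.
- move=> i j; case: (unliftP ord0 i) => [i' ->|->];
    case: (unliftP ord0 j) => [j' ->|->]; rewrite ?liftK ?unlift_none /=.
  + by rewrite eON (inj_eq (@lift_inj _ ord0)).
  + by rewrite innerC innerZl ye mulr0 rmorph0.
  + by rewrite innerZl ye mulr0.
  + rewrite innerZl innerZr conj_Creal ?realV ?gtr0_real // mulrA -invfM.
    by rewrite -expr2 sqrtCK mulVf ?gt_eqF.
- exists c^-1; rewrite unlift_none //=.
  by rewrite scalerA divff ?scale1r // gt_eqF.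
- by move=> i; rewrite liftK.
Qed.

Definition lin_closed (P : V -> Prop) : Prop :=
  P 0 /\ forall a x y, P x -> P y -> P (a *: x + y).

Lemma lin_closed_sum P (I : Type) (r : seq I) (Q : pred I) (a : I -> C)
    (x : I -> V) :
  lin_closed P -> (forall i, Q i -> P (x i)) ->
  P (\sum_(i <- r | Q i) a i *: x i).
Proof.
move=> [P0 Pl] Px; elim/big_ind: _ => // [u v Pu Pv|i Qi].
  by rewrite -[u]scale1r; apply: Pl.
by rewrite -[_ *: _]addr0; apply: Pl => //; apply: Px.
Qed.

(* Spans are handled impredicatively: [lin_closed] predicates holding on [s]. *)
Lemma gram_schmidt (s : seq V) :
  exists n (e : 'I_n -> V),
    [/\ orthonormal_family e, forall x, x \in s -> in_span_on e x
      & forall P, lin_closed P -> (forall x, x \in s -> P x) ->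
        forall i, P (e i)].
Proof.
elim: s => [|x s [n [e [eON es eP]]]].
  exists 0, (fun=> 0); split=> [[] //|//|P _ _ []] //.
pose y := x - \sum_i f x (e i) *: e i.
have [y0|y0] := eqVneq y 0.
  exists n, e; split=> // [z|P Pl sP i].
    by rewrite inE => /predU1P[->|/es //]; apply/eqP; rewrite -subr_eq0 -/y y0.
  by apply: eP => // z zs; apply: sP; rewrite inE zs orbT.
have [] := orthonormal_extend eON y0 (fun i => residual_orth x i eON).
move=> e' [e'ON [c e'0 y_e'] e'S]; exists n.+1, e'; split=> // [z|P Pl sP i].
  rewrite inE => /predU1P[->|/es zE].
    have -> : x = \sum_i oapp (fun i => f x (e i)) (sqrtC (f y y)) (unlift ord0 i) *: e' i.
      rewrite big_ord_recl unlift_none /= -y_e' /y.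
      rewrite [X in _ + X](eq_bigr (fun i => f x (e i) *: e i)) ?addrNK // => i _.
      by rewrite liftK e'S.
    exact: in_span_comb.
  have -> : z = \sum_i oapp (fun i => f z (e i)) 0 (unlift ord0 i) *: e' i.
    rewrite big_ord_recl unlift_none scale0r add0r [LHS]zE.
    by apply: eq_bigr => i _; rewrite liftK e'S.
  exact: in_span_comb.
have Pe j : P (e j).
  by apply: eP => // z zs; apply: sP; rewrite inE zs orbT.
case: (unliftP ord0 i) => [j ->|->]; first by rewrite e'S.
have [P0 PL] := Pl; rewrite e'0 -[_ *: _]addr0; apply: (PL) => //.
have -> : y = 1 *: x + \sum_j - f x (e j) *: e j.
  by rewrite scale1r /y -sumrN; congr (_ + _); apply: eq_bigr => j _; rewrite scaleNr.
by apply: PL; [exact/sP/mem_head|exact: lin_closed_sum].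
Qed.

Lemma orthonormal_bound m n (e : 'I_m -> V) (b : 'I_n -> V)
    (M : 'I_m -> 'I_n -> C) :
  orthonormal_family e -> (forall i, e i = \sum_j M i j *: b j) -> (m <= n)%N.
Proof.
move=> eON eE; rewrite leqNgt; apply/negP => nm.
have [r [i /eqP ri] r0] := linear_dependence nm eE.
by case: ri; rewrite -(orthonormal_coef r i eON) r0 inner0l.
Qed.

End Theory.
End InnerProduct.

Lemma iter_linear (K : nzRingType) (V : lmodType K) (T : {linear V -> V}) n a x y :
  iter n T (a *: x + y) = a *: iter n T x + iter n T y.
Proof. by elim: n => //= n ->; rewrite linearP. Qed.

(** * Spectral calculus for a positive, locally finite operator *)

Section FunctionalCalculus.
Variables (C : numClosedFieldType) (V : lmodType C).
Variables (f : V -> V -> C) (T : {linear V -> V}).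
Hypotheses (fI : is_inner f) (Tsa : forall x y, f (T x) y = f x (T y)).
Hypothesis Tpos : forall x, x != 0 -> 0 < f (T x) x.

Definition poly_act (p : {poly C}) (x : V) : V :=
  \sum_(i < size p) p`_i *: iter i T x.

Lemma poly_act_wide n (p : {poly C}) x : (size p <= n)%N ->
  poly_act p x = \sum_(i < n) p`_i *: iter i T x.
Proof.
move=> pn; rewrite /poly_act (big_ord_widen n (fun i => p`_i *: iter i T x) pn).
rewrite big_mkcond; apply: eq_bigr => i _; case: ltnP => // pi.
by rewrite nth_default // scale0r.
Qed.

Lemma poly_act_mulXsubC (q : {poly C}) a x :
  poly_act (q * ('X - a%:P)) x = poly_act q (T x - a *: x).
Proof.
have sq : (size (q * ('X - a%:P))%R <= (size q).+1)%N.
  by rewrite (leq_trans (size_polyMleq _ _)) // size_XsubC addn2.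
rewrite (poly_act_wide _ sq) (eq_bigr (fun i : 'I__ =>
  (q * 'X)`_i *: iter i T x + (- a * q`_i) *: iter i T x)); last first.
  move=> i _; rewrite -scalerDl mulrBr coefB [q * a%:P]mulrC coefCM.
  by rewrite mulNr.
rewrite big_split /= big_ord_recl coefMX /= scale0r add0r.
rewrite [X in _ + X]big_ord_recr /= nth_default // mulr0 scale0r addr0.
rewrite -big_split /=; apply: eq_bigr => i _.
rewrite coefMX /= -iterS iterSr -scaleNr [T x + _]addrC iter_linear scalerDr.
by rewrite scalerA addrC mulrC.
Qed.

Definition eigen_list (s : seq (C * V)) : Prop :=
  forall p, p \in s -> 0 < p.1 /\ T p.2 = p.1 *: p.2.

Lemma eigenvalue_gt0 a v : v != 0 -> T v = a *: v -> 0 < a.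
Proof.
by move=> v0 Tv; have := Tpos v0; rewrite Tv (innerZl fI) pmulr_lgt0 // inner_gt0.
Qed.

(** Induction on the degree. A root [a] of [p] is split off and [(T - a) x] is decomposed. Its
    components for eigenvalues other than [a] have preimages under [T - a]; the component for [a]
    vanishes because a selfadjoint operator has no Jordan block. *)
Lemma eigen_decomp (p : {poly C}) x : p != 0 -> poly_act p x = 0 ->
  exists2 s, eigen_list s & x = \sum_(q <- s) q.2.
Proof.
have [n] := ubnP (size p); elim: n p x => // n IHn p x pn p0 px.
have [/eqP p1|] := boolP (size p == 1).
  exists [::] => //; rewrite big_nil; move: px.
  rewrite /poly_act p1 big_ord1 /= => /eqP; rewrite scaler_eq0 => /orP[|/eqP//].
  by move: p0; rewrite -lead_coef_eq0 lead_coefE p1 => /negPf ->.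
move=> /closed_rootP[a /factor_theorem[q pE]].
have q0 : q != 0 by apply: contraNneq p0 => q0; rewrite pE q0 mul0r.
have qn : (size q < n)%N.
  by move: pn; rewrite pE size_Mmonic ?monicXsubC // size_XsubC addn2.
have [|s sE yE] := IHn q (T x - a *: x) qn q0.
  by rewrite -poly_act_mulXsubC -pE.
(* Removing the preimages of all components with eigenvalue other than [a] leaves
   [(T - a) z = w]. *)
pose z := x - \sum_(r <- s | r.1 != a) (r.1 - a)^-1 *: r.2.
pose w := \sum_(r <- s | r.1 == a) r.2.
have zw : T z - a *: z = w.
  rewrite linearB scalerBr opprB [_ - a *: x]addrC addrACA yE [- T _ + _]addrC.
  rewrite -opprB.
  rewrite (bigID (fun r => r.1 == a)) /= -/w -[RHS]addr0 -addrA; congr (_ + _).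
  rewrite linear_sum scaler_sumr -sumrB -sumrB big_seq_cond big1 // => r.
  case/andP=> rs ra; rewrite [T _]linearZ /= (proj2 (sE r rs)) !scalerA -scalerBl.
  by rewrite mulrC -mulrBl divff ?scale1r ?subrr // subr_eq0.
have Tw : T w = a *: w.
  rewrite linear_sum scaler_sumr big_seq_cond [RHS]big_seq_cond.
  by apply: eq_bigr => r /andP[rs /eqP <-]; case: (sE r rs).
(* [w] lies in the image and in the kernel of [T - a]. If it were nonzero, positivity would make [a]
   real, and then [<w, w> = <z, (T - a) w> = 0]. *)
have w0 : w = 0.
  apply/eqP; case: eqVneq => // w0; have a0 := eigenvalue_gt0 w0 Tw.
  case/eqP: (w0); apply: (inner_eq0 fI).
  transitivity (f (T z - a *: z) w); first by rewrite zw.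
  rewrite (innerDl fI) (innerNl fI) (innerZl fI) Tsa Tw (innerZr fI).
  by rewrite conj_Creal ?gtr0_real // subrr.
pose s' := [seq (r.1, (r.1 - a)^-1 *: r.2) | r <- s & r.1 != a].
have s'E : eigen_list s'.
  move=> r' /mapP[r + ->]; rewrite mem_filter => /andP[_ /sE[r0 Tr]] /=; split=> //.
  by rewrite linearZ /= Tr !scalerA mulrC.
have xE : x = z + \sum_(r <- s') r.2.
  by rewrite big_map big_filter /= /z subrK.
have [z0|z0] := eqVneq z 0; first by exists s'; rewrite // {1}xE z0 add0r.
have Tz : T z = a *: z by apply/eqP; rewrite -subr_eq0 zw w0.
exists ((a, z) :: s'); last by rewrite big_cons.
move=> r; rewrite inE => /predU1P[->|/s'E//] /=; split=> //.
exact: eigenvalue_gt0 z0 Tz.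
Qed.

Lemma iter_dependent_decomp n (r : 'I_n -> C) x :
  (exists i, r i != 0) -> \sum_i r i *: iter i T x = 0 ->
  exists2 s, eigen_list s & x = \sum_(q <- s) q.2.
Proof.
case=> i ri rx; pose p := \poly_(j < n) odflt 0 (omap r (insub j)).
have pr (j : 'I_n) : p`_j = r j by rewrite coef_poly ltn_ord valK.
apply: (@eigen_decomp p).
  by apply: contraNneq ri => p0; rewrite -pr p0 coef0.
rewrite (@poly_act_wide n) ?size_poly //; apply: etrans rx.
by apply: eq_bigr => j _; rewrite pr.
Qed.

Lemma eigen_orth a b u v : 0 < b -> T u = a *: u -> T v = b *: v ->
  a != b -> f u v = 0.
Proof.
move=> b0 Tu Tv ab; apply/eqP; move: (Tsa u v); rewrite Tu Tv (innerZl fI).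
rewrite (innerZr fI) conj_Creal ?gtr0_real // => /eqP.
by rewrite -subr_eq0 -mulrBl mulf_eq0 subr_eq0 (negPf ab).
Qed.

Definition weighted_sum (g : C -> C) (s : seq (C * V)) : V :=
  \sum_(p <- s) g p.1 *: p.2.

(** This makes the functional calculus well defined. Pairing with an eigenvector [p.2] sees only the
    terms of the same eigenvalue, where [g] is the constant [g p.1]; so the weighted sum is
    orthogonal to each of its own terms. *)
Lemma weighted_sum_eq0 g s : eigen_list s -> \sum_(p <- s) p.2 = 0 ->
  weighted_sum g s = 0.
Proof.
move=> sE s0; apply: (inner_eq0 fI).
rewrite {1}/weighted_sum (inner_suml fI) big_seq big1 // => p ps.
have [p0 Tp] := sE p ps.
suff -> : f p.2 (weighted_sum g s) = (g p.1)^* * f p.2 (\sum_(q <- s) q.2).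
  by rewrite s0 (inner0r fI) !mulr0.
rewrite (eq_bigr (fun q => 1 *: q.2)) => [|q _]; last by rewrite scale1r.
rewrite !(inner_sumr fI) mulr_sumr; apply: eq_big_seq => q qs.
have [q0 Tq] := sE q qs; rewrite rmorph1 mul1r.
have [->|pq] := eqVneq p.1 q.1; first by [].
by rewrite (eigen_orth q0 Tp Tq) // !mulr0.
Qed.

Hypothesis dec : forall x, exists2 s, eigen_list s & x = \sum_(q <- s) q.2.

(** The decomposition is picked by choice; [fun_calcE] shows that any other one gives the same
    value. Only the values of [g] at positive numbers matter. *)
Definition fun_calc (g : C -> C) (x : V) : V :=
  weighted_sum g (s2val (cid2 (dec x))).

Lemma fun_calcE g s : eigen_list s ->
  fun_calc g (\sum_(q <- s) q.2) = weighted_sum g s.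
Proof.
move=> sE; rewrite /fun_calc; case: cid2 => t /= tE st.
apply/eqP; rewrite -subr_eq0.
(* Two decompositions of the same vector, one of them negated, form a single list with sum zero. *)
pose s' := [seq (q.1, - q.2) | q <- s].
have <- : weighted_sum g (t ++ s') = weighted_sum g t - weighted_sum g s.
  rewrite /weighted_sum big_cat big_map /= -sumrN; congr (_ + _).
  by apply: eq_bigr => q _; rewrite scalerN.
rewrite weighted_sum_eq0 // => [p|].
  rewrite mem_cat => /orP[/tE//|/mapP[q /sE[q0 Tq] -> /=]].
  by rewrite linearN Tq scalerN.
by rewrite big_cat big_map /= sumrN st subrr.
Qed.

Fact fun_calc_linear g : linear (fun_calc g).
Proof.
move=> a x y; have [s sE ->] := dec x; have [t tE ->] := dec y.
pose s' := [seq (q.1, a *: q.2) | q <- s].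
have -> : a *: \sum_(q <- s) q.2 + \sum_(q <- t) q.2
          = \sum_(q <- s' ++ t) q.2.
  by rewrite big_cat big_map scaler_sumr.
rewrite !fun_calcE // => [|p].
  rewrite /weighted_sum big_cat big_map scaler_sumr /=; congr (_ + _).
  by apply: eq_bigr => q _; rewrite !scalerA mulrC.
rewrite mem_cat => /orP[/mapP[q /sE[q0 Tq] -> /=]|/tE//].
by rewrite linearZ /= Tq !scalerA mulrC.
Qed.

HB.instance Definition _ g :=
  GRing.isLinear.Build C V V *:%R (fun_calc g) (fun_calc_linear g).

Lemma fun_calc_eigen g a v : 0 < a -> T v = a *: v -> fun_calc g v = g a *: v.
Proof.
move=> a0 Tv; have <- : \sum_(q <- [:: (a, v)]) q.2 = v by rewrite big_seq1.
rewrite fun_calcE ?/weighted_sum ?big_seq1 //= => p.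
by rewrite inE => /eqP ->.
Qed.

Lemma eigen_ind (P : V -> Prop) : P 0 -> (forall x y, P x -> P y -> P (x + y)) ->
  (forall a v, 0 < a -> T v = a *: v -> P v) -> forall x, P x.
Proof.
move=> P0 PD Pe x; have [s sE ->] := dec x; rewrite big_seq.
by elim/big_ind: _ => // q /sE[q0 Tq]; apply: Pe q0 Tq.
Qed.

Lemma eq_on_eigen (F G : V -> V) : linear F -> linear G ->
  (forall a v, 0 < a -> T v = a *: v -> F v = G v) -> F =1 G.
Proof.
move=> Fl Gl FG; suff : forall x, F x - G x = 0.
  by move=> FG0 x; apply/eqP; rewrite -subr_eq0 FG0.
have F0 : F 0 = 0 by have := Fl (-1) 0 0; rewrite scaler0 addr0 scaleN1r addNr.
have G0 : G 0 = 0 by have := Gl (-1) 0 0; rewrite scaler0 addr0 scaleN1r addNr.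
apply: eigen_ind => [|x y Fx Fy|a v a0 Tv].
- by rewrite F0 G0 subrr.
- rewrite -[x]scale1r Fl Gl !scale1r opprD addrACA.
  by rewrite Fx Fy addr0.
- by rewrite (FG a) // subrr.
Qed.

Lemma fun_calc_comp g h x :
  fun_calc g (fun_calc h x) = fun_calc (fun a => g a * h a) x.
Proof.
apply: (eq_on_eigen (linearP (fun_calc g \o fun_calc h)) (linearP _)) => a v a0 Tv /=.
by rewrite (fun_calc_eigen h a0 Tv) linearZ /= !(fun_calc_eigen _ a0 Tv) scalerA mulrC.
Qed.

Lemma fun_calc_ext g h : (forall a, 0 < a -> g a = h a) ->
  fun_calc g =1 fun_calc h.
Proof.
move=> gh; apply: (eq_on_eigen (linearP _) (linearP _)) => a v a0 Tv /=.
by rewrite !(fun_calc_eigen _ a0 Tv) gh.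
Qed.

Lemma fun_calc_id : fun_calc id =1 T.
Proof.
by apply: (eq_on_eigen (linearP _) (linearP _)) => a v a0 Tv /=;
  rewrite (fun_calc_eigen _ a0 Tv) Tv.
Qed.

Lemma fun_calc1 x : fun_calc (fun=> 1) x = x.
Proof.
apply: (eq_on_eigen (linearP _) (linearP idfun)) => a v a0 Tv /=.
by rewrite (fun_calc_eigen _ a0 Tv) scale1r.
Qed.

Lemma fun_calc_comm g (L : {linear V -> V}) :
  (forall x, T (L x) = L (T x)) -> forall x, fun_calc g (L x) = L (fun_calc g x).
Proof.
move=> TL; apply: (eq_on_eigen (linearP (fun_calc g \o L)) (linearP (L \o fun_calc g))).
move=> a v a0 Tv /=; rewrite [in RHS](fun_calc_eigen _ a0 Tv) linearZ /=.
by rewrite (@fun_calc_eigen g a) // TL Tv linearZ.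
Qed.

Lemma fun_calc_selfadjoint g : (forall a, 0 < a -> g a \is Num.real) ->
  forall x y, f (fun_calc g x) y = f x (fun_calc g y).
Proof.
move=> gR x y; move: x; apply: eigen_ind => [|x x' IH IH'|a u a0 Tu].
- by rewrite linear0 !(inner0l fI).
- by rewrite linearD !(innerDl fI) IH IH'.
move: y; apply: eigen_ind => [|y y' IH IH'|b v b0 Tv].
- by rewrite linear0 !(inner0r fI).
- by rewrite linearD !(innerDr fI) IH IH'.
rewrite (fun_calc_eigen _ a0 Tu) (fun_calc_eigen _ b0 Tv) (innerZl fI) (innerZr fI).
rewrite conj_Creal ?gR //; have [->//|ab] := eqVneq a b.
by rewrite (eigen_orth b0 Tu Tv) // !mulr0.
Qed.

Lemma fun_calc_inj g : (forall a, 0 < a -> g a != 0) ->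
  forall x, fun_calc g x = 0 -> x = 0.
Proof.
move=> g0 x gx; rewrite -[x]fun_calc1.
rewrite -(@fun_calc_ext (fun a => (g a)^-1 * g a)) => [|a a0].
  by rewrite -fun_calc_comp gx linear0.
by rewrite mulVf ?g0.
Qed.

(** Since [h(T) = g(T) g(T)], the number [<h(T) x, x>] is the square norm of [g(T) x]. *)
Lemma fun_calc_gt0 g h : (forall a, 0 < a -> 0 < g a) ->
  (forall a, 0 < a -> h a = g a ^+ 2) ->
  forall x, x != 0 -> 0 < f (fun_calc h x) x.
Proof.
move=> g0 hg x x0; rewrite (fun_calc_ext hg).
rewrite -(@fun_calc_comp g g) fun_calc_selfadjoint => [|a /g0/gtr0_real//].
apply: inner_gt0 => //; apply: contraNneq x0 => /fun_calc_inj -> // a /g0.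
by move/lt0r_neq0.
Qed.

End FunctionalCalculus.

(** * Coalgebras and unitary corepresentations *)

Definition pack_linear (K : nzRingType) (V W : lmodType K) (f : V -> W)
    (fl : linear f) : {linear V -> W} :=
  HB.pack f (GRing.isLinear.Build K V W *:%R f fl).

Definition pack_scalar (K : nzRingType) (V : lmodType K) (f : V -> K)
    (fl : scalar f) : {scalar V} :=
  HB.pack f (GRing.isLinear.Build K V K *%R f fl).

Section TensorLift.
Variables (K : comNzRingType) (V W : lmodType K).

Lemma balanced_bilinear (U : lmodType K) (f : V -> W -> U) :
  (forall w, linear (f^~ w)) -> (forall v, linear (f v)) -> balanced f.
Proof.
move=> fl fr; split=> [w u v|v u w|a v w].
- by rewrite -[u in LHS]scale1r fl scale1r.
- by rewrite -[u in LHS]scale1r fr scale1r.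
- have F0 v' : f v' 0 = 0.
    by have := fr v' (-1) 0 0; rewrite scaler0 addr0 scaleN1r addNr.
  have F0' w' : f 0 w' = 0.
    by have := fl w' (-1) 0 0; rewrite scaler0 addr0 scaleN1r addNr.
  by rewrite -[a *: v]addr0 -[a *: w]addr0 fl fr F0 F0'.
Qed.

Lemma tensor_lift0 (G : zmodType) (f : V -> W -> G) :
  balanced f -> tensor_lift f 0 = 0.
Proof.
move=> fB; apply: (addIr (tensor_lift f 0)).
by rewrite -tensor_liftD // !add0r.
Qed.

Lemma tensor_lift_sum (G : zmodType) (f : V -> W -> G) (I : Type) (r : seq I)
    (P : pred I) (v : I -> V) (w : I -> W) : balanced f ->
  tensor_lift f (\sum_(i <- r | P i) v i \ox w i)
  = \sum_(i <- r | P i) f (v i) (w i).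
Proof.
move=> fB; rewrite (big_morph _ (tensor_liftD fB) (tensor_lift0 fB)).
by apply: eq_bigr => i _; rewrite tensor_lift_tens.
Qed.

Lemma tensor_liftE (G : zmodType) (f : V -> W -> G) t :
  tensor_lift f t = \sum_(p <- repr t) f p.1 p.2.
Proof. by []. Qed.

Lemma eq_tensor_lift (G : zmodType) (f g : V -> W -> G) t :
  (forall v w, f v w = g v w) -> tensor_lift f t = tensor_lift g t.
Proof. by move=> fg; rewrite !tensor_liftE; apply: eq_bigr => p _; rewrite fg. Qed.

Lemma linear_tensl (w : W) : linear (fun v : V => v \ox w).
Proof.
by move=> a x y; case: (balanced_tens V W) => -> _ _; rewrite tens_scalel.
Qed.

Lemma tens_scaler a (v : V) (w : W) : v \ox (a *: w) = a *: (v \ox w).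
Proof. by rewrite -tens_scalel; case: (balanced_tens V W). Qed.

Lemma linear_tensr (v : V) : linear (fun w : W => v \ox w).
Proof.
by move=> a x y; case: (balanced_tens V W) => _ -> _; rewrite tens_scaler.
Qed.

Lemma tens0l (w : W) : (0 : V) \ox w = 0.
Proof. exact: (linear0 (pack_linear (linear_tensl w))). Qed.

Lemma tens0r (v : V) : v \ox (0 : W) = 0.
Proof. exact: (linear0 (pack_linear (linear_tensr v))). Qed.

Lemma tens_suml (I : Type) (r : seq I) (P : pred I) (v : I -> V) (w : W) :
  (\sum_(i <- r | P i) v i) \ox w = \sum_(i <- r | P i) v i \ox w.
Proof. exact: (linear_sum (pack_linear (linear_tensl w))). Qed.

Lemma tens_sumr (I : Type) (r : seq I) (P : pred I) (w : I -> W) (v : V) :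
  v \ox (\sum_(i <- r | P i) w i) = \sum_(i <- r | P i) v \ox w i.
Proof. exact: (linear_sum (pack_linear (linear_tensr v))). Qed.

Lemma tensor_lift_linear (U : lmodType K) (f : V -> W -> U) :
  (forall w, linear (f^~ w)) -> (forall v, linear (f v)) ->
  linear (tensor_lift f).
Proof.
move=> fl fr a t u; have fB := balanced_bilinear fl fr.
rewrite tensor_liftD // tensor_liftZ // => v w.
exact: (linearZ_LR (pack_linear (fl w))).
Qed.

End TensorLift.

Section Coalgebra.
Variables (K : comNzRingType) (V : coalgType K).
Implicit Types (g h : {scalar V}) (x : V).

Lemma balanced_convl g (W : lmodType K) :
  balanced (fun (a : V) (b : W) => g a *: b).
Proof.
apply: balanced_bilinear => [w a x y|v a x y].
  by rewrite linearP scalerDl scalerA.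
by rewrite scalerDr !scalerA mulrC.
Qed.

Lemma balanced_convr g (W : lmodType K) :
  balanced (fun (a : W) (b : V) => g b *: a).
Proof.
apply: balanced_bilinear => [w a x y|v a x y].
  by rewrite scalerDr !scalerA mulrC.
by rewrite linearP scalerDl scalerA.
Qed.

Fact convl_linear g : linear (convl g).
Proof.
move=> a x y; rewrite /convl linearP tensor_liftD ?tensor_liftZ //.
- exact: balanced_convl.
- by move=> v w; rewrite linearZ scalerA.
- exact: balanced_convl.
Qed.

HB.instance Definition _ g :=
  GRing.isLinear.Build K V V *:%R (convl g) (convl_linear g).

Fact convr_linear g : linear (convr g).
Proof.
move=> a x y; rewrite /convr linearP tensor_liftD ?tensor_liftZ //.
- exact: balanced_convr.
- by move=> v w; rewrite !scalerA mulrC.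
- exact: balanced_convr.
Qed.

HB.instance Definition _ g :=
  GRing.isLinear.Build K V V *:%R (convr g) (convr_linear g).

Lemma counit_convl g x : counit (convl g x) = g x.
Proof.
rewrite -[in RHS](counitr x) /convl !tensor_liftE !linear_sum.
by apply: eq_bigr => p _; rewrite !linearZ /= mulrC.
Qed.

Lemma counit_convr g x : counit (convr g x) = g x.
Proof.
rewrite -[in RHS](counitl x) /convr !tensor_liftE !linear_sum.
by apply: eq_bigr => p _; rewrite !linearZ /= mulrC.
Qed.


Lemma comulA_sum x :
  \sum_(p <- repr (comul x)) \sum_(q <- repr (comul p.1)) q.1 \ox (q.2 \ox p.2)
  = \sum_(p <- repr (comul x)) p.1 \ox comul p.2.
Proof.
have aB : balanced (fun t (w : V) =>
    tensor_lift (fun u v : V => u \ox (v \ox w)) t).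
  apply: balanced_bilinear => [w|t a y z].
    apply: tensor_lift_linear => [v|v a y z]; first exact: linear_tensl.
    by rewrite linear_tensl linear_tensr.
  rewrite !tensor_liftE scaler_sumr -big_split; apply: eq_bigr => p _ /=.
  by rewrite linear_tensr linear_tensr.
by have := comulA x; rewrite /tensor_assoc tensor_lift_sum.
Qed.

(** Coassociativity with the last of the three legs contracted by [g]; [comul_convl] contracts the
    first leg instead. *)
Lemma comul_convr g x :
  comul (convr g x) = tensor_lift (fun p q => p \ox convr g q) (comul x).
Proof.
pose h (p : V) (q : tensor V V) := p \ox tensor_lift (fun a b => g b *: a) q.
have hB : balanced h.
  apply: balanced_bilinear => [t|v a s t]; first exact: linear_tensl.
  have cl : linear (tensor_lift (fun a b : V => g b *: a)).
    apply: tensor_lift_linear => [w c y z|w c y z].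
      by rewrite scalerDr !scalerA mulrC.
    by rewrite linearP scalerDl scalerA.
  by rewrite /h cl linear_tensr.
have := congr1 (tensor_lift h) (comulA_sum x).
rewrite tensor_lift_sum // => H; apply: etrans H.
rewrite (big_morph _ (tensor_liftD hB) (tensor_lift0 hB)).
rewrite [convr g x]tensor_liftE linear_sum; apply: eq_bigr => p _.
rewrite tensor_lift_sum // linearZ /= [X in _ *: X]tensor_repr scaler_sumr.
apply: eq_bigr => q _.
by rewrite /h tensor_lift_tens ?tens_scaler //; exact: balanced_convr.
Qed.

Lemma comul_convl g x :
  comul (convl g x) = tensor_lift (fun p q => convl g p \ox q) (comul x).
Proof.
have gB := balanced_convl g (tensor V V).
have := congr1 (tensor_lift (fun p (q : tensor V V) => g p *: q)) (comulA_sum x).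
rewrite tensor_lift_sum //.
rewrite (big_morph _ (tensor_liftD gB) (tensor_lift0 gB)) => H.
rewrite [convl g x]tensor_liftE linear_sum.
transitivity (\sum_(p <- repr (comul x)) g p.1 *: comul p.2).
  by apply: eq_bigr => p _; rewrite linearZ.
rewrite -H; apply: eq_bigr => p _.
rewrite tensor_lift_sum // /convl tensor_liftE tens_suml.
by apply: eq_bigr => q _; rewrite tens_scalel.
Qed.

Lemma convl_convr_comm g h x : convl g (convr h x) = convr h (convl g x).
Proof.
rewrite {1}/convl comul_convr [X in tensor_lift _ X]tensor_liftE.
rewrite tensor_lift_sum; last exact: balanced_convl.
rewrite [convl g x]/convl tensor_liftE linear_sum.
by apply: eq_bigr => p _; rewrite linearZ.
Qed.

Definition corep n (u : 'I_n -> 'I_n -> V) : Prop :=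
  (forall i j, comul (u i j) = \sum_k u i k \ox u k j) /\
  (forall i j, counit (u i j) = (i == j)%:R).

Lemma lift_corep n (u : 'I_n -> 'I_n -> V) (G : zmodType) (f : V -> V -> G)
    i j : corep u -> balanced f ->
  tensor_lift f (comul (u i j)) = \sum_k f (u i k) (u k j).
Proof. by move=> [uD _] fB; rewrite uD tensor_lift_sum. Qed.

Lemma convl_corep n (u : 'I_n -> 'I_n -> V) g i j : corep u ->
  convl g (u i j) = \sum_k g (u i k) *: u k j.
Proof. by move=> uC; rewrite /convl lift_corep //; exact: balanced_convl. Qed.

Lemma convr_corep n (u : 'I_n -> 'I_n -> V) g i j : corep u ->
  convr g (u i j) = \sum_k g (u k j) *: u i k.
Proof. by move=> uC; rewrite /convr lift_corep //; exact: balanced_convr. Qed.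

End Coalgebra.

(** * Finite-dimensional subcomodules and unitary matrix corepresentations *)

Section UnitaryCoreps.
Variables (C : numClosedFieldType) (V : circCoalgType C).
Variables (F : V -> V -> C).
Hypothesis FI : is_inner F.
Hypothesis Finv : forall u v : V,
  tensor_lift (fun u0 u1 => F u0 v *: u1) (comul u)
  = tensor_lift (fun v0 v1 => F u v0 *: circ v1) (comul v).

Definition dual_vec (y : V) : {scalar V} := pack_scalar (inner_scalar FI y).

Lemma comul_orthonormal_right (x : V) :
  exists n (e : 'I_n -> V), orthonormal_family F e /\
    comul x = \sum_i convr (dual_vec (e i)) x \ox e i.
Proof.
have [n [e [eON eS _]]] := gram_schmidt FI [seq p.2 | p <- repr (comul x)].
exists n, e; split=> //; rewrite [LHS]tensor_repr.
transitivity (\sum_(p <- repr (comul x)) \sum_i (F p.2 (e i) *: p.1) \ox e i).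
  apply: eq_big_seq => p px; rewrite {1}(eS p.2) ?map_f // tens_sumr.
  by apply: eq_bigr => i _; rewrite tens_scaler tens_scalel.
by rewrite exchange_big /=; apply: eq_bigr => i _; rewrite -tens_suml.
Qed.

Lemma comul_orthonormal_left m n (a b : 'I_m -> V) (e : 'I_n -> V) (x : V) :
  comul x = \sum_j a j \ox b j -> (forall j, in_span_on F e (a j)) ->
  comul x = \sum_i e i \ox convl (dual_vec (e i)) x.
Proof.
move=> xE aE; rewrite [in LHS]xE.
transitivity (\sum_j \sum_i e i \ox (F (a j) (e i) *: b j)).
  apply: eq_bigr => j _; rewrite {1}(aE j) tens_suml.
  by apply: eq_bigr => i _; rewrite tens_scaler tens_scalel.
rewrite exchange_big /=; apply: eq_bigr => i _; rewrite -tens_sumr /convl xE.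
by rewrite tensor_lift_sum //; exact: (balanced_convl (dual_vec (e i)) V).
Qed.

Definition unitary_corep n (u : 'I_n -> 'I_n -> V) : Prop :=
  corep u /\ forall i j, circ (u i j) = u j i.

(** The matrix of the coaction in the basis [e] is forced to have the entries [<-, e i> ⋆ id] at
    [e j]. In this form invariance of [F] is exactly the relation between [u i j] and [u j i]
    through the circle. *)
Lemma comodule_change_basis m (a : 'I_m -> V) (w : 'I_m -> 'I_m -> V)
    n (e : 'I_n -> V) (u := fun i j => convl (dual_vec (e i)) (e j)) :
  (forall j, comul (a j) = \sum_i a i \ox w i j) -> orthonormal_family F e ->
  (forall j, in_span_on F e (a j)) ->
  (forall P, lin_closed P -> (forall j, P (a j)) -> forall i, P (e i)) ->
  unitary_corep u /\ forall j, comul (e j) = \sum_i e i \ox u i j.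
Proof.
move=> aD eON aS eP.
have eD j : comul (e j) = \sum_i e i \ox u i j.
  move: j; apply: (eP (fun z =>
    comul z = \sum_i e i \ox convl (dual_vec (e i)) z)) => [|j].
    split=> [|c x y xE yE].
      rewrite linear0 big1 // => i _; rewrite linear0.
      by rewrite tens0r.
    rewrite linearP xE yE scaler_sumr -big_split; apply: eq_bigr => i _.
    by rewrite linearP linear_tensr.
  by rewrite (comul_orthonormal_left (aD j) aS).
split=> //; split; first split.
- move=> i j; rewrite comul_convl eD tensor_lift_sum //.
  apply: balanced_bilinear => [t c y z|v]; last exact: linear_tensr.
  by rewrite linearP linear_tensl.
- by move=> i j; rewrite counit_convl [LHS]eON eq_sym.
- move=> i j; rewrite /u /convl /= Finv !tensor_liftE linear_sum.
  by apply: eq_bigr => p _; rewrite linearZ /= circK -innerC.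
Qed.

Lemma comodule_orthonormal_basis m (a : 'I_m -> V) (w : 'I_m -> 'I_m -> V) :
  (forall j, comul (a j) = \sum_i a i \ox w i j) ->
  exists n (e : 'I_n -> V) (u : 'I_n -> 'I_n -> V),
    [/\ orthonormal_family F e, unitary_corep u,
        forall j, comul (e j) = \sum_i e i \ox u i j,
        forall j, in_span_on F e (a j)
      & forall P, lin_closed P -> (forall j, P (a j)) -> forall i, P (e i)].
Proof.
move=> aD; have [n [e [eON eS eP]]] := gram_schmidt FI (codom a).
have aS j : in_span_on F e (a j) by apply: eS; apply: codom_f.
have eP' P : lin_closed P -> (forall j, P (a j)) -> forall i, P (e i).
  by move=> Pl Pa; apply: eP => // _ /codomP[j ->].
have [uU eD] := comodule_change_basis aD eON aS eP'.
by exists n, e, (fun i j => convl (dual_vec (e i)) (e j)).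
Qed.

(** Local finiteness: the partial evaluations [a i] of [comul x] span a right subcomodule, and the
    counit axiom shows that it contains [x]. *)
Lemma unitary_corep_basis (x : V) :
  exists n (e : 'I_n -> V) (u : 'I_n -> 'I_n -> V),
    [/\ orthonormal_family F e, unitary_corep u,
        forall j, comul (e j) = \sum_i e i \ox u i j,
        in_span_on F e x
      & forall P, lin_closed P ->
          (forall g : {scalar V}, P (convr g x)) -> forall i, P (e i)].
Proof.
have [m [b [bON xD]]] := comul_orthonormal_right x.
pose a i := convr (dual_vec (b i)) x.
have aD j : comul (a j) = \sum_i a i \ox convr (dual_vec (b j)) (b i).
  rewrite /a comul_convr [in LHS]xD tensor_lift_sum //.
  apply: balanced_bilinear => [w|v c y z]; first exact: linear_tensl.
  by rewrite linearP linear_tensr.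
have [n [e [u [eON uU eD aS eP]]]] := comodule_orthonormal_basis aD.
exists n, e, u; split=> [|||| P Pl Px] //; last by apply: eP => // j; apply: Px.
rewrite -(counitr x) xD tensor_lift_sum; last exact: balanced_convr.
apply: lin_closed_sum => // [|i _]; last exact: aS.
split; last exact: in_spanP.
by rewrite /in_span_on big1 // => i _; rewrite inner0l // scale0r.
Qed.

Lemma comodule_basis_counit n (e : 'I_n -> V) (u : 'I_n -> 'I_n -> V) j :
  (forall j, comul (e j) = \sum_i e i \ox u i j) ->
  e j = \sum_i counit (e i) *: u i j.
Proof.
by move=> eD; rewrite -[LHS]counitl eD tensor_lift_sum //; exact: balanced_convl.
Qed.

(** The counit turns every basis vector of a subcomodule into a combination of entries of its
    matrix. Linear identities on the whole coalgebra thus become matrix identities. *)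
Lemma corep_ind (P : V -> Prop) : lin_closed P ->
  (forall n (u : 'I_n -> 'I_n -> V), unitary_corep u -> forall i j, P (u i j)) ->
  forall x, P x.
Proof.
move=> Pl Pu x; have [n [e [u [_ uU eD -> _]]]] := unitary_corep_basis x.
apply: lin_closed_sum => // j _; rewrite (comodule_basis_counit j eD).
by apply: lin_closed_sum => // i _; apply: Pu.
Qed.

Lemma eq_on_coreps (W : lmodType C) (L M : {linear V -> W}) :
  (forall n (u : 'I_n -> 'I_n -> V), unitary_corep u ->
     forall i j, L (u i j) = M (u i j)) -> L =1 M.
Proof.
move=> LM; apply: corep_ind => //; split=> [|a x y Lx Ly]; first by rewrite !linear0.
by rewrite !linearP Lx Ly.
Qed.

End UnitaryCoreps.

(** * Antipode *)

Lemma sum_delta_mul (R : nzRingType) n (x : 'I_n -> R) (i : 'I_n) :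
  \sum_k (i == k)%:R * x k = x i.
Proof.
rewrite (bigD1 i) //= eqxx mul1r big1 ?addr0 // => k.
by rewrite eq_sym => /negPf ->; rewrite mul0r.
Qed.

Lemma sum_mul_delta (R : nzRingType) n (x : 'I_n -> R) (i : 'I_n) :
  \sum_k x k * (k == i)%:R = x i.
Proof.
rewrite (bigD1 i) //= eqxx mulr1 big1 ?addr0 // => k /negPf ->.
by rewrite mulr0.
Qed.

Section TensorAlgebra.
Variables (K : comNzRingType) (H : algType K).
Implicit Types s t : tensor H H.

Definition tensor_mul s t : tensor H H :=
  tensor_lift (fun a b => tensor_lift (fun c d => (a * c) \ox (b * d)) t) s.

Lemma balanced_mul_tens (a b : H) :
  balanced (fun c d : H => (a * c) \ox (b * d)).
Proof.
apply: balanced_bilinear => [w k x y|v k x y].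
  by rewrite mulrDr -scalerAr linear_tensl.
by rewrite mulrDr -scalerAr linear_tensr.
Qed.

Lemma balanced_tensor_mul t :
  balanced (fun a b : H => tensor_lift (fun c d => (a * c) \ox (b * d)) t).
Proof.
apply: balanced_bilinear => [w k x y|v k x y];
  rewrite !tensor_liftE scaler_sumr -big_split; apply: eq_bigr => p _ /=.
- by rewrite mulrDl -scalerAl linear_tensl.
- by rewrite mulrDl -scalerAl linear_tensr.
Qed.

Lemma tensor_mul_linearl t : linear (tensor_mul^~ t).
Proof.
apply: tensor_lift_linear => [w k x y|v k x y];
  rewrite !tensor_liftE scaler_sumr -big_split; apply: eq_bigr => p _ /=.
- by rewrite mulrDl -scalerAl linear_tensl.
- by rewrite mulrDl -scalerAl linear_tensr.
Qed.

Lemma tensor_mul_linearr s : linear (tensor_mul s).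
Proof.
move=> k x y; rewrite /tensor_mul !(tensor_liftE _ s) scaler_sumr -big_split.
apply: eq_bigr => p _ /=; rewrite tensor_liftD; last exact: balanced_mul_tens.
rewrite tensor_liftZ // => [|v w]; first exact: balanced_mul_tens.
by rewrite -scalerAr tens_scalel.
Qed.

Lemma tensor_mul_suml (I : Type) (r : seq I) (P : pred I) (s : I -> tensor H H) t :
  tensor_mul (\sum_(i <- r | P i) s i) t = \sum_(i <- r | P i) tensor_mul (s i) t.
Proof. exact: (linear_sum (pack_linear (tensor_mul_linearl t))). Qed.

Lemma tensor_mul_sumr (I : Type) (r : seq I) (P : pred I) (t : I -> tensor H H) s :
  tensor_mul s (\sum_(i <- r | P i) t i) = \sum_(i <- r | P i) tensor_mul s (t i).
Proof. exact: (linear_sum (pack_linear (tensor_mul_linearr s))). Qed.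

Lemma tensor_mulZl k s t : tensor_mul (k *: s) t = k *: tensor_mul s t.
Proof. exact: (linearZ_LR (pack_linear (tensor_mul_linearl t))). Qed.

Lemma tensor_mulZr k s t : tensor_mul s (k *: t) = k *: tensor_mul s t.
Proof. exact: (linearZ_LR (pack_linear (tensor_mul_linearr s))). Qed.

Lemma tensor_mul_tens a b c d :
  tensor_mul (a \ox b) (c \ox d) = (a * c) \ox (b * d).
Proof.
rewrite /tensor_mul tensor_lift_tens; last exact: balanced_tensor_mul.
by rewrite tensor_lift_tens //; exact: balanced_mul_tens.
Qed.

Lemma tensor_ind (P : tensor H H -> Prop) :
  (forall a b, P (a \ox b)) -> P 0 -> (forall s t, P s -> P t -> P (s + t)) ->
  forall t, P t.
Proof. by move=> Pt P0 PD t; rewrite (tensor_repr t); elim/big_ind: _. Qed.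

Lemma tensor_mulDl s s' t :
  tensor_mul (s + s') t = tensor_mul s t + tensor_mul s' t.
Proof. by rewrite -[s]scale1r tensor_mul_linearl !scale1r. Qed.

Lemma tensor_mulDr s t t' :
  tensor_mul s (t + t') = tensor_mul s t + tensor_mul s t'.
Proof. by rewrite -[t]scale1r tensor_mul_linearr !scale1r. Qed.

Lemma tensor_mul0l t : tensor_mul 0 t = 0.
Proof. by rewrite -[0](scale0r 0) tensor_mulZl !scale0r. Qed.

Lemma tensor_mul0r s : tensor_mul s 0 = 0.
Proof. by rewrite -[0](scale0r 0) tensor_mulZr !scale0r. Qed.

Lemma tensor_mulA r s t :
  tensor_mul r (tensor_mul s t) = tensor_mul (tensor_mul r s) t.
Proof.
elim/tensor_ind: r => [a b||r r' IH IH']; last 2 first.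
- by rewrite !tensor_mul0l.
- by rewrite !tensor_mulDl IH IH'.
elim/tensor_ind: s => [c d||s s' IH IH']; last 2 first.
- by rewrite !(tensor_mul0l, tensor_mul0r).
- by rewrite !(tensor_mulDl, tensor_mulDr) IH IH'.
elim/tensor_ind: t => [e f||t t' IH IH']; last 2 first.
- by rewrite !tensor_mul0r.
- by rewrite !tensor_mulDr IH IH'.
by rewrite !tensor_mul_tens !mulrA.
Qed.

Lemma tensor_mul1 s : tensor_mul (1 \ox 1) s = s.
Proof.
elim/tensor_ind: s => [a b||s t IH IH']; last 2 first.
- by rewrite tensor_mul0r.
- by rewrite tensor_mulDr IH IH'.
by rewrite tensor_mul_tens !mul1r.
Qed.

Lemma tensor_1mul s : tensor_mul s (1 \ox 1) = s.
Proof.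
elim/tensor_ind: s => [a b||s t IH IH']; last 2 first.
- by rewrite tensor_mul0l.
- by rewrite tensor_mulDl IH IH'.
by rewrite tensor_mul_tens !mulr1.
Qed.

End TensorAlgebra.

(** * The antipode on matrix coefficients *)

Section HopfCoreps.
Variables (K : comNzRingType) (H : hopfAlgType K).
Local Notation S := (antipode : {linear H -> H}).

Lemma antipode_corepl n (u : 'I_n -> 'I_n -> H) i j : corep u ->
  \sum_k S (u i k) * u k j = (i == j)%:R.
Proof.
move=> uC; have := antipodel (u i j); rewrite lift_corep //.
  by move=> ->; case: uC => _ ->; rewrite scaler_nat.
apply: balanced_bilinear => [w c x y|v c x y].
  by rewrite linearP mulrDl -scalerAl.
by rewrite mulrDr -scalerAr.
Qed.

Lemma antipode_corepr n (u : 'I_n -> 'I_n -> H) i j : corep u ->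
  \sum_k u i k * S (u k j) = (i == j)%:R.
Proof.
move=> uC; have := antipoder (u i j); rewrite lift_corep //.
  by move=> ->; case: uC => _ ->; rewrite scaler_nat.
apply: balanced_bilinear => [w c x y|v c x y].
  by rewrite mulrDl -scalerAl.
by rewrite linearP mulrDr -scalerAr.
Qed.

Lemma antipode1 : S 1 = 1.
Proof.
have := antipodel (1 : H); rewrite comul1 tensor_lift_tens ?counit1 ?mulr1.
  by rewrite scale1r.
apply: balanced_bilinear => [w c x y|v c x y].
  by rewrite linearP mulrDl -scalerAl.
by rewrite mulrDr -scalerAr.
Qed.

Lemma comulM_corep n m (u : 'I_n -> 'I_n -> H) (v : 'I_m -> 'I_m -> H) i j k l :
  corep u -> corep v ->
  comul (u i j * v k l) = \sum_p \sum_q (u i p * v k q) \ox (u p j * v q l).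
Proof.
move=> [uD _] [vD _]; rewrite comulM -/(tensor_mul _ _) uD vD tensor_mul_suml.
apply: eq_bigr => p _; rewrite tensor_mul_sumr.
by apply: eq_bigr => q _; rewrite tensor_mul_tens.
Qed.

(** Both sides invert the matrix of the products [u i j * v k l]: the left one from the left, by the
    antipode axiom at the product, the right one from the right, by the axiom for [u] and [v]
    separately. A left and a right inverse coincide. *)
Lemma antipodeM_corep n m (u : 'I_n -> 'I_n -> H) (v : 'I_m -> 'I_m -> H) i p k q :
  corep u -> corep v -> S (u i p * v k q) = S (v k q) * S (u i p).
Proof.
move=> uC vC.
have uv j l : \sum_a \sum_b S (u i a * v k b) * (u a j * v b l)
              = (i == j)%:R * (k == l)%:R.
  have := antipodel (u i j * v k l); rewrite (comulM_corep _ _ _ _ uC vC).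
  have sB : balanced (fun a b : H => S a * b).
    apply: balanced_bilinear => [w c x y|w c x y].
      by rewrite linearP mulrDl -scalerAl.
    by rewrite mulrDr -scalerAr.
  rewrite (big_morph _ (tensor_liftD sB) (tensor_lift0 sB)).
  under eq_bigr => a _ do rewrite tensor_lift_sum //.
  move=> ->; rewrite counitM; case: uC => _ ->; case: vC => _ ->.
  by rewrite -!natrM scaler_nat.
transitivity (\sum_j \sum_l (i == j)%:R * (k == l)%:R * (S (v l q) * S (u j p))).
  transitivity (\sum_a \sum_b S (u i a * v k b) * ((a == p)%:R * (b == q)%:R)).
    rewrite -[LHS](sum_mul_delta (fun a => S (u i a * v k q))).
    apply: eq_bigr => a _.
    rewrite -[X in X * _](sum_mul_delta (fun b => S (u i a * v k b))) mulr_suml.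
    by apply: eq_bigr => b _; rewrite -!mulrA -!natrM mulnC.
  have uvS a b : (a == p)%:R * (b == q)%:R
      = \sum_j \sum_l u a j * v b l * (S (v l q) * S (u j p)) :> H.
    rewrite -(antipode_corepr a p uC) mulr_suml; apply: eq_bigr => j _.
    transitivity (u a j * ((b == q)%:R * S (u j p))).
      by rewrite -mulrA !mulr_natr mulr_natl.
    rewrite -(antipode_corepr b q vC) mulr_suml mulr_sumr.
    by apply: eq_bigr => l _; rewrite !mulrA.
  transitivity (\sum_a \sum_b \sum_j \sum_l
      S (u i a * v k b) * (u a j * v b l) * (S (v l q) * S (u j p))).
    apply: eq_bigr => a _; apply: eq_bigr => b _; rewrite uvS mulr_sumr.
    apply: eq_bigr => j _; rewrite mulr_sumr; apply: eq_bigr => l _.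
    by rewrite !mulrA.
  under eq_bigr => a _ do rewrite exchange_big.
  rewrite exchange_big; apply: eq_bigr => j _ /=.
  under eq_bigr => a _ do rewrite exchange_big.
  rewrite exchange_big; apply: eq_bigr => l _ /=.
  by rewrite -uv mulr_suml; apply: eq_bigr => a _; rewrite mulr_suml.
rewrite -[RHS](sum_delta_mul (fun j => S (v k q) * S (u j p))).
apply: eq_bigr => j _.
rewrite -(sum_delta_mul (fun l => S (v l q) * S (u j p)) k) mulr_sumr.
by apply: eq_bigr => l _; rewrite !mulrA.
Qed.

(** For the coproduct, the same principle over [H ⊗ H]: the matrix of the [comul (u i j)] has the
    matrix of the [comul (S (u i j))] as left inverse ([XD]) and [W] as right inverse ([DW]). *)
Lemma antipode_corep n (u : 'I_n -> 'I_n -> H) :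
  corep u -> corep (fun i j => S (u j i)).
Proof.
move=> uC; split=> i j; last first.
  have := congr1 counit (antipode_corepl j i uC); rewrite linear_sum.
  have -> : counit ((j == i)%:R : H) = (j == i)%:R.
    by rewrite -scaler_nat linearZ /= counit1 mulr1.
  rewrite eq_sym => <-.
  rewrite -[LHS](sum_mul_delta (fun k => counit (S (u j k)))).
  by apply: eq_bigr => k _; rewrite counitM; case: uC => _ ->.
pose W i j := \sum_k S (u k j) \ox S (u i k).
pose I2 : tensor H H := 1 \ox 1.
have XD a b : \sum_k tensor_mul (comul (S (u a k))) (comul (u k b)) = (a == b)%:R *: I2.
  under eq_bigr => k _ do rewrite /tensor_mul -comulM.
  rewrite -linear_sum antipode_corepl // -scaler_nat linearZ /= comul1.
  by [].
have DW a b : \sum_k tensor_mul (comul (u a k)) (W k b) = (a == b)%:R *: I2.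
  transitivity (\sum_k \sum_p \sum_q
      (u a p * S (u q b)) \ox (u p k * S (u k q))).
    apply: eq_bigr => k _; case: (uC) => -> _; rewrite tensor_mul_suml.
    apply: eq_bigr => p _; rewrite tensor_mul_sumr; apply: eq_bigr => q _.
    by rewrite tensor_mul_tens.
  rewrite exchange_big /=.
  transitivity (\sum_p (u a p * S (u p b)) \ox (1 : H)).
    apply: eq_bigr => p _; rewrite exchange_big /=.
    under eq_bigr => q _ do rewrite -tens_sumr antipode_corepr //.
    rewrite (bigD1 p) //= eqxx big1 ?addr0 // => q.
    rewrite eq_sym => /negPf ->.
    by rewrite tens0r.
  rewrite -tens_suml antipode_corepr //; case: (a == b); first by rewrite scale1r.
  by rewrite scale0r; by rewrite tens0l.
transitivity (\sum_k tensor_mul (comul (S (u j k))) ((k == i)%:R *: I2)).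
  rewrite (bigD1 i) //= eqxx scale1r tensor_1mul big1 ?addr0 // => k /negPf ->.
  by rewrite scale0r tensor_mul0r.
transitivity (\sum_l tensor_mul ((j == l)%:R *: I2) (W l i)).
  transitivity (\sum_k \sum_l
      tensor_mul (tensor_mul (comul (S (u j k))) (comul (u k l))) (W l i)).
    apply: eq_bigr => k _; rewrite -DW tensor_mul_sumr.
    by apply: eq_bigr => l _; rewrite tensor_mulA.
  by rewrite exchange_big; apply: eq_bigr => l _; rewrite -XD tensor_mul_suml.
rewrite (bigD1 j) //= eqxx scale1r tensor_mul1 big1 ?addr0 // => l.
by rewrite eq_sym => /negPf ->; rewrite scale0r tensor_mul0l.
Qed.

End HopfCoreps.

(** * The inverse antipode and the involution of the algebra *)

Section UnitaryHopf.
Variables (C : numClosedFieldType) (H : circHopfAlgType C).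
Variables (F : H -> H -> C).
Hypothesis FI : is_inner F.
Hypothesis Finv : forall u v : H,
  tensor_lift (fun u0 u1 => F u0 v *: u1) (comul u)
  = tensor_lift (fun v0 v1 => F u v0 *: circ v1) (comul v).
Local Notation S := (antipode : {linear H -> H}).

Lemma antipodeM (x y : H) : S (x * y) = S y * S x.
Proof.
move: x y; apply: (corep_ind FI Finv).
  split=> [y|a x z IHx IHz y]; first by rewrite mul0r linear0 mulr0.
  by rewrite mulrDl -scalerAl !linearP IHx IHz /= mulrDr scalerAr.
move=> n u [uC _] i j; apply: (corep_ind FI Finv).
  split=> [|a x z IHx IHz]; first by rewrite mulr0 linear0 mul0r.
  by rewrite mulrDr -scalerAr !linearP IHx IHz /= mulrDl scalerAl.
by move=> m v [vC _] k l; apply: antipodeM_corep.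
Qed.

Lemma circ1 : circ (1 : H) = 1.
Proof. by rewrite -[LHS]mulr1 -{2}[1]circK -circM mul1r circK. Qed.

Lemma circ_nat n : circ (n%:R : H) = n%:R.
Proof.
by elim: n => [|n IH]; rewrite ?linear0 // -natr1 linearD /= IH circ1.
Qed.

(** The inverse of [S]: the circle keeps the product and reverses the coproduct, so conjugating [S]
    by it gives the antipode of the co-opposite Hopf algebra. *)
Definition inv_antipode (x : H) : H := circ (S (circ x)).
Local Notation Si := inv_antipode.

Fact inv_antipode_linear : linear Si.
Proof. by move=> a x y; rewrite /Si !linearP /= conjCK. Qed.

HB.instance Definition _ :=
  GRing.isLinear.Build C H H *:%R Si inv_antipode_linear.

Lemma inv_antipodeM x y : Si (x * y) = Si y * Si x.
Proof. by rewrite /Si circM antipodeM circM. Qed.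

Lemma inv_antipode_corepl n (u : 'I_n -> 'I_n -> H) i j : unitary_corep u ->
  \sum_p Si (u p j) * u i p = (i == j)%:R.
Proof.
move=> [uC uU]; rewrite eq_sym -[RHS]circ_nat -(antipode_corepl j i uC) linear_sum.
by apply: eq_bigr => p _; rewrite /Si uU circM uU.
Qed.

Lemma inv_antipode_corepr n (u : 'I_n -> 'I_n -> H) i j : unitary_corep u ->
  \sum_p u p j * Si (u i p) = (i == j)%:R.
Proof.
move=> [uC uU]; rewrite eq_sym -[RHS]circ_nat -(antipode_corepr j i uC) linear_sum.
by apply: eq_bigr => p _; rewrite /Si uU circM uU.
Qed.

(** Up to transposition, the matrices of the [u i j] and of the [Si (S (u i j))] are inverses, on
    opposite sides, of the matrix of the [Si (u i j)]. *)
Lemma antipodeK x : Si (S x) = x.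
Proof.
move: x; apply: (eq_on_coreps FI Finv (L := Si \o S) (M := idfun)).
move=> n u uU i l /=; case: (uU) => uC _.
have Su a b : \sum_k Si (u k a) * Si (S (u b k)) = (b == a)%:R.
  have := congr1 Si (antipode_corepl b a uC); rewrite linear_sum.
  have -> : Si (b == a)%:R = (b == a)%:R by rewrite /Si circ_nat; case: (_ == _);
    rewrite ?antipode1 ?linear0 ?circ1 ?linear0.
  by move=> <-; apply: eq_bigr => k _; rewrite /= inv_antipodeM.
transitivity (\sum_k (l == k)%:R * Si (S (u i k))); first by rewrite sum_delta_mul.
transitivity (\sum_j u j l * (i == j)%:R); last first.
  by under eq_bigr do rewrite eq_sym; rewrite sum_mul_delta.
transitivity (\sum_k \sum_j u j l * Si (u k j) * Si (S (u i k))).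
  apply: eq_bigr => k _; rewrite eq_sym -(inv_antipode_corepr k l uU).
  by rewrite mulr_suml.
rewrite exchange_big; apply: eq_bigr => j _ /=; rewrite -Su mulr_sumr.
by apply: eq_bigr => k _; rewrite mulrA.
Qed.

Lemma inv_antipodeK x : S (Si x) = x.
Proof.
have -> : S (Si x) = circ (Si (S (circ x))) by rewrite /Si !circK.
by rewrite antipodeK circK.
Qed.

Definition star (x : H) : H := S (circ x).

Lemma starK x : star (star x) = x. Proof. exact: inv_antipodeK. Qed.

Lemma starM x y : star (x * y) = star y * star x.
Proof. by rewrite /star circM antipodeM. Qed.

Lemma starP a x y : star (a *: x + y) = a^* *: star x + star y.
Proof. by rewrite /star !linearP. Qed.

Lemma star0 : star 0 = 0. Proof. by rewrite /star !linear0. Qed.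

Lemma star_eq0 x : (star x == 0) = (x == 0).
Proof.
apply/eqP/eqP => [x0|->]; last exact: star0.
by rewrite -[x]starK x0 star0.
Qed.

Lemma star_antipode x : star (S x) = circ x.
Proof.
have -> : star (S x) = S (Si (circ x)) by rewrite /star /Si circK.
by rewrite inv_antipodeK.
Qed.

End UnitaryHopf.

(** * Cosemisimplicity *)

Section StableSubspaces.
Variables (C : numClosedFieldType) (V : coalgType C).
Implicit Types (D E : {pred V}) (g : {scalar V}).

Lemma submod_lin_closed D :
  GRing.submod_closed D <-> lin_closed (fun x => x \in D).
Proof. by split=> -[D0 Dl]; split=> // a x y; apply: Dl. Qed.

Lemma subcoalgebra_convl D g x : subcoalgebra D -> x \in D -> convl g x \in D.
Proof.
move=> [/submod_lin_closed Dl DD] /DD[s /allP sD xE].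
rewrite /convl xE tensor_lift_sum; last exact: balanced_convl.
by rewrite big_seq; apply: (lin_closed_sum _ _ Dl) => p /sD/andP[].
Qed.

Lemma subcoalgebra_convr D g x : subcoalgebra D -> x \in D -> convr g x \in D.
Proof.
move=> [/submod_lin_closed Dl DD] /DD[s /allP sD xE].
rewrite /convr xE tensor_lift_sum; last exact: balanced_convr.
by rewrite big_seq; apply: (lin_closed_sum _ _ Dl) => p /sD/andP[].
Qed.

End StableSubspaces.

Section Cosemisimple.
Variables (C : numClosedFieldType) (V : circCoalgType C).
Variables (F : V -> V -> C).
Hypothesis FI : is_inner F.
Hypothesis Finv : forall u v : V,
  tensor_lift (fun u0 u1 => F u0 v *: u1) (comul u)
  = tensor_lift (fun v0 v1 => F u v0 *: circ v1) (comul v).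
Implicit Types (D E : {pred V}) (g : {scalar V}).

(** [comul x] can be written with left legs in the span of elements [id ⋆ g] of [x] and right legs
    of the form [g ⋆ id] of [x], so stability under both kinds of operators puts all legs in [D]. *)
Lemma stable_subcoalgebra D : lin_closed (fun x => x \in D) ->
  (forall g x, x \in D -> convl g x \in D) ->
  (forall g x, x \in D -> convr g x \in D) -> subcoalgebra D.
Proof.
move=> Dl Dcl Dcr; split=> [|x xD]; first exact/submod_lin_closed.
have [m [b [bON xE]]] := comul_orthonormal_right FI x.
pose a i := convr (dual_vec FI (b i)) x.
have [n [e [eON eS eP]]] := gram_schmidt FI (codom a).
have aS j : in_span_on F e (a j) by apply: eS; apply: codom_f.
exists [seq (e i, convl (dual_vec FI (e i)) x) | i <- index_enum 'I_n].
  apply/allP => _ /mapP[i _ ->]; apply/andP; split; last exact: Dcl.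
  by apply: (eP (fun x => x \in D)) => // _ /codomP[j ->]; apply: Dcr.
by rewrite big_map (comul_orthonormal_left FI xE aS).
Qed.

Definition orth_compl D : {pred V} :=
  fun x => `[< forall d, d \in D -> F x d = 0 >].

Lemma orth_complP D x :
  reflect (forall d, d \in D -> F x d = 0) (x \in orth_compl D).
Proof. exact: asboolP. Qed.

Lemma orth_compl_lin_closed D : lin_closed (fun x => x \in orth_compl D).
Proof.
split=> [|a x y /orth_complP xD /orth_complP yD]; apply/orth_complP => d dD.
  by rewrite inner0l.
by rewrite innerDl // innerZl // xD // yD // mulr0 addr0.
Qed.

(** Invariance of [F] moves the coaction from [x] to [d], whose first legs stay in [D] and are
    therefore orthogonal to [x]. *)
Lemma orth_compl_convr D g x : subcoalgebra D ->
  x \in orth_compl D -> convr g x \in orth_compl D.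
Proof.
move=> DS /orth_complP xD; apply/orth_complP => d dD.
have hs : scalar (fun z : V => (g (circ z))^*).
  by move=> a y z; rewrite !linearP /= rmorphD rmorphM /= conjCK.
pose h := pack_scalar hs.
rewrite (innerC FI); apply/eqP; rewrite conjC_eq0; apply/eqP.
transitivity (h (tensor_lift (fun v0 v1 => F d v0 *: circ v1) (comul x))).
  rewrite /convr !tensor_liftE linear_sum inner_sumr //.
  by apply: eq_bigr => p _; rewrite linearZ /= circK mulrC.
rewrite -Finv; case: DS => _ /(_ d dD)[s /allP sD ->].
rewrite tensor_lift_sum; last exact: (balanced_convl (dual_vec FI x) V).
rewrite big_seq big1 ?linear0 // => p /sD/andP[pD _].
by rewrite (innerC FI) xD // rmorph0 scale0r.
Qed.

(* With T = convl g and P the projection onto the comodule spanned by e, the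
   adjoint of P T maps d in D to [Td] below; being a comodule map defined on the
   subcoalgebra D it takes its values in D, hence in D and its complement. *)
Lemma orth_compl_convl D g x : subcoalgebra D ->
  x \in orth_compl D -> convl g x \in orth_compl D.
Proof.
move=> DS xD; have [n [e [u [eON [uC uU] eD xe eP]]]] := unitary_corep_basis FI Finv x.
have eO i : e i \in orth_compl D.
  move: i; apply: (eP (fun z => z \in orth_compl D)).
    exact: orth_compl_lin_closed.
  by move=> h; apply: orth_compl_convr.
apply/orth_complP => d dD.
pose Td := \sum_i F d (convl g (e i)) *: e i.
have TdO : Td \in orth_compl D.
  by apply: (lin_closed_sum _ _ (orth_compl_lin_closed D)) => i _.
have TdD : Td \in D.
  have -> : Td = \sum_k counit (e k) *: convl (dual_vec FI (convl g (e k))) d.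
    have cE k : convl (dual_vec FI (convl g (e k))) d
                = \sum_i F d (convl g (e i)) *: u k i.
      rewrite [LHS]Finv comul_convl eD.
      have lB : balanced (fun p q : V => convl g p \ox q).
        apply: balanced_bilinear => [w c y z|v]; last exact: linear_tensr.
        by rewrite linearP linear_tensl.
      rewrite (tensor_lift_sum _ _ _ _ lB) tensor_lift_sum.
        by apply: eq_bigr => i _; rewrite uU.
      split=> [w y z|v y z|a v w].
      - by rewrite innerDr // scalerDl.
      - by rewrite linearD scalerDr.
      - by rewrite innerZr // linearZ /= scalerA mulrC.
    rewrite /Td; transitivity (\sum_k \sum_i
        counit (e k) *: (F d (convl g (e i)) *: u k i)); last first.
      by apply: eq_bigr => k _; rewrite -scaler_sumr -cE.
    rewrite exchange_big; apply: eq_bigr => i _ /=.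
    rewrite [X in _ *: X](comodule_basis_counit i eD) scaler_sumr; apply: eq_bigr => k _.
    by rewrite !scalerA mulrC.
  case: (DS) => /submod_lin_closed Dl _; apply: (lin_closed_sum _ _ Dl) => k _.
  exact: subcoalgebra_convl.
have Td0 : Td = 0 by apply: (inner_eq0 FI); move/orth_complP: TdO; apply.
rewrite xe linear_sum (eq_bigr (fun i => F x (e i) *: convl g (e i))).
  rewrite inner_suml // big1 // => i _; rewrite [F (convl _ _) d](innerC FI).
  by rewrite -(orthonormal_coef FI (fun i => F d (convl g (e i))) i eON) -/Td Td0
    inner0l // rmorph0 mulr0.
by move=> i _; rewrite linearZ.
Qed.

Lemma orth_subcoalgebra D : subcoalgebra D -> subcoalgebra (orth_compl D).
Proof.
move=> DS; apply: stable_subcoalgebra => [|g x|g x].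
- exact: orth_compl_lin_closed.
- exact: orth_compl_convl.
- exact: orth_compl_convr.
Qed.

Lemma subcoalgebraI D E : subcoalgebra D -> subcoalgebra E ->
  subcoalgebra [predI D & E].
Proof.
move=> DS ES; have [[/submod_lin_closed Dl _] [/submod_lin_closed El _]] := (DS, ES).
apply: stable_subcoalgebra => [|g x|g x].
- split=> [|a x y]; first by rewrite inE; apply/andP; case: Dl => -> _; case: El.
  rewrite !inE => /andP[xD xE] /andP[yD yE]; apply/andP.
  by split; [apply Dl|apply El].
- by rewrite !inE => /andP[xD xE]; rewrite !subcoalgebra_convl.
- by rewrite !inE => /andP[xD xE]; rewrite !subcoalgebra_convr.
Qed.

(** A bound on the dimension of a subspace [D], put in the form in which [orthonormal_extend] can
    contradict it. *)
Definition rank_le D n : Prop :=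
  forall m (e : 'I_m -> V), orthonormal_family F e -> (forall i, e i \in D) ->
  (m <= n)%N.

Lemma rank_le_extend D n m (e : 'I_m -> V) y : rank_le D n.+1 ->
  lin_closed (fun x => x \in D) -> orthonormal_family F e ->
  (forall i, e i \in D) -> y \in D -> y != 0 -> (forall i, F y (e i) = 0) ->
  (m <= n)%N.
Proof.
move=> Dn [D0 Dl] eON eD yD y0 ye.
have [e' [e'ON [c e'0 _] e'S]] := orthonormal_extend FI eON y0 ye.
have := Dn _ e' e'ON; rewrite ltnS; apply=> i.
case: (unliftP ord0 i) => [j ->|->]; first by rewrite e'S.
by rewrite e'0 -[_ *: _]addr0; apply: Dl.
Qed.

(** A largest orthonormal family in [D] spans [D], because a nonzero residue would extend it;
    subtracting the Fourier sum then projects. *)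
Lemma orth_projection D n : rank_le D n -> lin_closed (fun x => x \in D) ->
  forall x, exists2 d, d \in D & x - d \in orth_compl D.
Proof.
move=> Dn Dl x.
pose P m := `[< exists e : 'I_m -> V, orthonormal_family F e /\ forall i, e i \in D >].
have P0 : exists m, P m by exists 0; apply/asboolP; exists (fun=> 0); split=> -[].
have Pn m : P m -> (m <= n)%N by move=> /asboolP[e [eON eD]]; apply: Dn eON eD.
case: (ex_maxnP P0 Pn) => m /asboolP[e [eON eD]] mmax.
exists (\sum_i F x (e i) *: e i); first exact: (lin_closed_sum _ _ Dl).
apply/orth_complP => d dD.
pose y := d - \sum_i F d (e i) *: e i.
have yD : y \in D.
  have [D0 DL] := Dl; rewrite /y addrC -scaleN1r; apply: (DL) => //.
  exact: (lin_closed_sum _ _ Dl).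
have ye i : F y (e i) = 0 by apply: residual_orth.
have [y0|y0] := eqVneq y 0.
  have -> : d = \sum_i F d (e i) *: e i by apply/eqP; rewrite -subr_eq0 -/y y0.
  rewrite inner_sumr // big1 // => i _; rewrite residual_orth // mulr0.
  by [].
have [e' [e'ON [c e'0 _] e'S]] := orthonormal_extend FI eON y0 ye.
suff /mmax : P m.+1 by rewrite ltnn.
apply/asboolP; exists e'; split=> // i; case: (unliftP ord0 i) => [j ->|->].
  by rewrite e'S.
by rewrite e'0 -[_ *: _]addr0; case: (Dl) => D0 DL; apply: DL.
Qed.

Lemma normalize y : y != 0 -> exists2 c, c != 0 & F (c *: y) (c *: y) = 1.
Proof.
move=> y0; have eON0 : orthonormal_family F (fun _ : 'I_0 => 0) by case.
have [|e [eON [c e0 yE] _]] := orthonormal_extend FI eON0 y0; first by case.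
exists c; last by rewrite -e0 eON eqxx.
by apply: contra_neq y0 => c0; rewrite yE e0 c0 scale0r scaler0.
Qed.

(* Induction on the dimension of D: a non-simple D is the sum of a proper
   subcoalgebra and of its orthogonal complement in D. *)
Lemma simple_ind_rank (P : V -> Prop) : lin_closed P ->
  (forall D, simple_subcoalgebra D -> forall x, x \in D -> P x) ->
  forall n D, subcoalgebra D -> rank_le D n -> forall x, x \in D -> P x.
Proof.
move=> Pl Ps; elim=> [|n IHn] D DS Dn x xD.
  have [->|x0] := eqVneq x 0; first by case: Pl.
  have [/submod_lin_closed[D0 Dl] _] := DS.
  suff : (0 < 0)%N by [].
  have [c c0 cx] := normalize x0.
  apply: (Dn 1 (fun=> c *: x)) => [i j|_]; first by rewrite !ord1 eqxx.
  by rewrite -[_ *: _]addr0; apply: Dl.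
have [DP|/existsNP[E /not_implyP[ES /not_implyP[ED]]]] :=
  pselect (forall E, subcoalgebra E -> {subset E <= D} ->
             (exists2 x, x \in E & x != 0) -> {subset D <= E}).
  have [->|x0] := eqVneq x 0; first by case: Pl.
  by apply: (Ps D) => //; split=> //; exists x.
move=> /not_implyP[[y yE y0] /existsNP[z /not_implyP[zD /negP zE]]].
have [[/submod_lin_closed Dl _] [/submod_lin_closed El _]] := (DS, ES).
have E'S : subcoalgebra [predI D & orth_compl E].
  exact/subcoalgebraI/orth_subcoalgebra.
have En1 : rank_le E n.+1 by move=> m e eON eE; apply: Dn eON _ => i; exact/ED.
have proj w : w \in D ->
    exists2 d, d \in E & w - d \in [predI D & orth_compl E].
  move=> wD; have [d dE wd] := orth_projection En1 El w.
  exists d => //; rewrite inE wd andbT addrC -scaleN1r.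
  by apply: (proj2 Dl) => //; apply: ED.
have [d dE zd] := proj z zD.
have zd0 : z - d != 0.
  by apply: contraNneq zE => /eqP; rewrite subr_eq0 => /eqP ->.
(* Both pieces lose a dimension: an orthonormal family of [E] can be extended within [D] by [z - d],
   and one of the complement by [y]. *)
have En : rank_le E n.
  move=> m e eON eE; apply: (rank_le_extend Dn Dl eON _ _ zd0) => [i||i].
  - exact/ED.
  - by move: zd; rewrite inE => /andP[].
  - by move: zd; rewrite inE => /andP[_ /orth_complP]; apply.
have E'n : rank_le [predI D & orth_compl E] n.
  move=> m e eON eE; apply: (rank_le_extend Dn Dl eON _ _ y0) => [i||i].
  - by have := eE i; rewrite inE => /andP[].
  - exact/ED.
  - have := eE i; rewrite inE => /andP[_ /orth_complP/(_ _ yE) ey].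
    by rewrite (innerC FI) ey rmorph0.
have [d' d'E xd'] := proj x xD.
rewrite -(subrK d' x) -[x - d']scale1r; apply: (proj2 Pl).
  exact: (IHn _ E'S E'n).
exact: (IHn _ ES En).
Qed.

(** The entries of a corepresentation span a subcoalgebra of finite dimension, to which
    [simple_ind_rank] applies. *)
Lemma simple_ind (P : V -> Prop) : lin_closed P ->
  (forall D, simple_subcoalgebra D -> forall x, x \in D -> P x) ->
  forall x, P x.
Proof.
move=> Pl Ps; apply: (corep_ind FI Finv Pl) => n u [uC _] i j.
pose D : {pred V} := fun x =>
  `[< exists c : 'I_n -> 'I_n -> C, x = \sum_k \sum_l c k l *: u k l >].
have uD k l : u k l \in D.
  apply/asboolP; exists (fun k' l' => ((k' == k) && (l' == l))%:R).
  rewrite (bigD1 k) //= (bigD1 l) //= !eqxx scale1r !big1 ?addr0 // => k'.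
    by move=> /negPf k'k; rewrite big1 // => l' _; rewrite k'k scale0r.
  by move=> /negPf ->; rewrite scale0r.
have Dl : lin_closed (fun x => x \in D).
  split=> [|a x y /asboolP[c ->] /asboolP[c' ->]]; apply/asboolP.
    exists (fun _ _ => 0); rewrite big1 // => k _; rewrite big1 // => l _.
    by rewrite scale0r.
  exists (fun k l => a * c k l + c' k l); rewrite scaler_sumr -big_split.
  apply: eq_bigr => k _; rewrite scaler_sumr -big_split; apply: eq_bigr => l _.
  by rewrite scalerDl scalerA.
have DP (Q : V -> Prop) : lin_closed Q -> (forall k l, Q (u k l)) ->
    forall x, x \in D -> Q x.
  move=> Ql Qu _ /asboolP[c ->]; elim/big_ind: _ => [|y z Qy Qz|k _].
  - by case: Ql.
  - by rewrite -[y]scale1r; apply: (proj2 Ql).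
  - exact: (lin_closed_sum _ _ Ql).
have DS : subcoalgebra D.
  apply: stable_subcoalgebra => // g; apply: (DP (fun x => _ x \in D)).
  - split=> [|a x y xD yD]; first by rewrite linear0; case: Dl.
    by rewrite linearP; apply: (proj2 Dl).
  - by move=> k l; rewrite convl_corep //; apply: (lin_closed_sum _ _ Dl).
  - split=> [|a x y xD yD]; first by rewrite linear0; case: Dl.
    by rewrite linearP; apply: (proj2 Dl).
  - by move=> k l; rewrite convr_corep //; apply: (lin_closed_sum _ _ Dl).
apply: (simple_ind_rank Pl Ps DS (n := #|{: 'I_n * 'I_n}|)) => // m e eON eD.
have /choice[M ME] i' : exists c : 'I_n -> 'I_n -> C,
    e i' = \sum_k \sum_l c k l *: u k l by exact/asboolP/eD.
pose b (k : 'I_#|{: 'I_n * 'I_n}|) := u (enum_val k).1 (enum_val k).2.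
apply: (orthonormal_bound FI (b := b)
  (M := fun i k => M i (enum_val k).1 (enum_val k).2)) eON _ => i'.
rewrite ME pair_big /= (reindex (@enum_val _ {: 'I_n * 'I_n})) //=.
by apply: onW_bij; exists enum_rank; [exact: enum_valK|exact: enum_rankK].
Qed.

End Cosemisimple.

(** * The normal integral and its inner product *)

(** Both sides are [f ⊗ g] evaluated at [comul x]. *)
Lemma scalar_convl_convr (K : comNzRingType) (V : coalgType K)
    (f g : {scalar V}) x : g (convl f x) = f (convr g x).
Proof.
rewrite /convl /convr !tensor_liftE !linear_sum; apply: eq_bigr => p _.
by rewrite !linearZ /= mulrC.
Qed.

Section NormalIntegral.
Variables (C : numClosedFieldType) (H : circHopfAlgType C).
Variables (F : H -> H -> C).
Hypothesis FI : is_inner F.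
Hypothesis Finv : forall u v : H,
  tensor_lift (fun u0 u1 => F u0 v *: u1) (comul u)
  = tensor_lift (fun v0 v1 => F u v0 *: circ v1) (comul v).
Variable phi : {scalar H}.
Hypothesis phiN : normal_integral phi.
Local Notation S := (antipode : {linear H -> H}).
Local Notation Si := (@inv_antipode C H).

Lemma normal_integral1 : phi 1 = 1.
Proof. by case: phiN => /(_ 1); rewrite scale1r. Qed.

(** It suffices to look at simple subcoalgebras. On the scalars this is the normalization; in any
    other one the left legs of [comul x] can be taken where [phi] vanishes. *)
Lemma convl_integral x : convl phi x = (phi x)%:A.
Proof.
move: x; apply: (simple_ind FI Finv) => [|D Ds x xD].
  split=> [|a x y xE yE]; first by rewrite !linear0 scale0r.
  by rewrite !linearP /= xE yE scalerDl scalerA.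
have [DC|/phiN.2 phi0] := pselect (forall x, x \in D <-> exists a : C, x = a%:A).
  have [a ->] := (DC x).1 xD; rewrite !linearZ /= normal_integral1 mulr1.
  rewrite /convl comul1 tensor_lift_tens ?normal_integral1 ?scale1r //.
  exact: balanced_convl.
rewrite (phi0 Ds) // scale0r; have {}phi0 := phi0 Ds.
case: Ds => -[_ /(_ x xD)[s /allP sD xE]] _ _.
rewrite /convl xE tensor_lift_sum; last exact: balanced_convl.
by rewrite big_seq big1 // => p /sD/andP[pD _]; rewrite phi0 // scale0r.
Qed.

Lemma convr_integral x : convr phi x = (phi x)%:A.
Proof.
move: x; apply: (simple_ind FI Finv) => [|D Ds x xD].
  split=> [|a x y xE yE]; first by rewrite !linear0 scale0r.
  by rewrite !linearP /= xE yE scalerDl scalerA.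
have [DC|/phiN.2 phi0] := pselect (forall x, x \in D <-> exists a : C, x = a%:A).
  have [a ->] := (DC x).1 xD; rewrite !linearZ /= normal_integral1 mulr1.
  rewrite /convr comul1 tensor_lift_tens ?normal_integral1 ?scale1r //.
  exact: balanced_convr.
rewrite (phi0 Ds) // scale0r; have {}phi0 := phi0 Ds.
case: Ds => -[_ /(_ x xD)[s /allP sD xE]] _ _.
rewrite /convr xE tensor_lift_sum; last exact: balanced_convr.
by rewrite big_seq big1 // => p /sD/andP[_ pD]; rewrite phi0 // scale0r.
Qed.

Lemma integral_uniq (f : {scalar H}) :
  (forall x, convl f x = (f x)%:A) -> f 1 = 1 -> f =1 phi.
Proof.
move=> fl f1 x; have := scalar_convl_convr f phi x.
by rewrite fl convr_integral !linearZ /= normal_integral1 f1 !mulr1.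
Qed.

(** [S] reverses the coproduct, so right invariance of [phi] makes [phi ∘ S] left invariant, and
    uniqueness applies. [integral_circ] follows the same pattern. *)
Lemma integral_antipode x : phi (S x) = phi x.
Proof.
have fs : scalar (phi \o S) by move=> a y z /=; rewrite !linearP.
apply: (@integral_uniq (pack_scalar fs)) => [y|]; last first.
  by rewrite /= antipode1 normal_integral1.
apply: (can_inj (antipodeK FI Finv)); rewrite linearZ /= antipode1.
move: y; apply: (corep_ind FI Finv) => [|n u [uC _] i j].
  split=> [|a y z yE zE]; first by rewrite !linear0 scale0r.
  by rewrite !linearP /= yE zE scalerDl scalerA.
rewrite convl_corep // -convr_integral.
rewrite (convr_corep phi j i (antipode_corep uC)) linear_sum.
by apply: eq_bigr => k _; rewrite linearZ.
Qed.

Lemma integral_circ x : phi (circ x) = (phi x)^*.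
Proof.
have fs : scalar (fun x => (phi (circ x))^*).
  by move=> a y z /=; rewrite !linearP /= rmorphD rmorphM /= conjCK.
suff /(_ x) : pack_scalar fs =1 phi by move=> /= <-; rewrite conjCK.
apply: integral_uniq => [y|]; last by rewrite /= circ1 normal_integral1 rmorph1.
move: y; apply: (corep_ind FI Finv) => [|n u [uC uU] i j].
  split=> [|a y z yE zE]; first by rewrite !linear0 scale0r.
  by rewrite !linearP /= yE zE scalerDl scalerA.
rewrite convl_corep //= uU.
have := congr1 (circ : H -> H) (convr_integral (u j i)).
rewrite convr_corep // linear_sum linearZ /= circ1 => <-.
by apply: eq_bigr => k _; rewrite linearZ /= !uU.
Qed.

Lemma integral_star x : phi (star x) = (phi x)^*.
Proof. by rewrite integral_antipode integral_circ. Qed.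

Local Notation ip := (inner_product phi).

Lemma inner_productE x y : ip x y = phi (star y * x). Proof. by []. Qed.

Lemma inner_product_conj x y : ip y x = (ip x y)^*.
Proof. by rewrite !inner_productE -integral_star (starM FI Finv) (starK FI Finv). Qed.

Lemma inner_product_scalar z : scalar (ip^~ z).
Proof. by move=> a x y; rewrite !inner_productE mulrDr -scalerAr linearP. Qed.

Fact mull_scalar a : scalar (fun x => phi (a * x)).
Proof. by move=> c x y; rewrite mulrDr -scalerAr linearP. Qed.

Fact mulr_scalar b : scalar (fun x => phi (x * b)).
Proof. by move=> c x y; rewrite mulrDl -scalerAl linearP. Qed.

Definition integral_mull a : {scalar H} := pack_scalar (mull_scalar a).
Definition integral_mulr b : {scalar H} := pack_scalar (mulr_scalar b).

Lemma lin_closed_eq (W : lmodType C) (L M : H -> W) : linear L -> linear M ->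
  lin_closed (fun x => L x = M x).
Proof.
move=> Ll Ml; split=> [|a x y xE yE]; last by rewrite Ll Ml xE yE.
by rewrite -[0](subrr 0) -scaleN1r addrC -[L _]subr0 Ll Ml !scaleN1r !addNr subr0.
Qed.

(** Strong invariance: [phi(a x1) x2 = S^-1(phi(a1 x) a2)] in Sweedler notation. On the right,
    invariance expands the scalar [phi(a1 x) 1] to [phi(a1 x1) a2 x2], and then [S^-1(a3) a2]
    collapses to the counit. *)
Lemma convl_mull a x :
  convl (integral_mull a) x = Si (convl (integral_mulr x) a).
Proof.
have linA x' : linear (fun a' => convl (integral_mull a') x').
  move=> c y z; rewrite /convl !tensor_liftE scaler_sumr -big_split.
  apply: eq_bigr => p _ /=.
  by rewrite mulrDl -scalerAl linearP /= scalerDl scalerA.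
have linX a' : linear (fun x' => Si (convl (integral_mulr x') a')).
  move=> c y z; rewrite -linearP; congr Si.
  rewrite /convl !tensor_liftE scaler_sumr -big_split; apply: eq_bigr => p _ /=.
  by rewrite mulrDr -scalerAr linearP /= scalerDl scalerA.
move: a; apply: (corep_ind FI Finv) => [|n v vU k l].
  apply: lin_closed_eq => // c y z.
  by rewrite !linearP.
move: x; apply: (corep_ind FI Finv) => [|m u [uC _] i j].
  by apply: lin_closed_eq => // c y z; rewrite linearP.
have [vC _] := vU; rewrite !convl_corep // linear_sum /=.
transitivity (\sum_p Si (v p l) * (phi (v k p * u i j))%:A); last first.
  by apply: eq_bigr => p _; rewrite linearZ mulr_algr.
transitivity (\sum_p \sum_q \sum_m0
    phi (v k q * u i m0) *: (Si (v p l) * v q p * u m0 j)); last first.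
  apply: eq_bigr => p _; rewrite -convl_integral /convl (comulM_corep _ _ _ _ vC uC).
  rewrite (big_morph _ (tensor_liftD (balanced_convl phi H))
    (tensor_lift0 (balanced_convl phi H))) mulr_sumr; apply: eq_bigr => q _.
  rewrite tensor_lift_sum ?mulr_sumr; last exact: balanced_convl.
  by apply: eq_bigr => m0 _; rewrite -scalerAr mulrA.
rewrite exchange_big /= (bigD1 l) //= [X in _ + X]big1 ?addr0.
  rewrite exchange_big /=; apply: eq_bigr => m0 _.
  by rewrite -scaler_sumr -mulr_suml (inv_antipode_corepl _ _ vU) eqxx mul1r.
move=> q ql; rewrite exchange_big big1 //= => m0 _.
rewrite -scaler_sumr -mulr_suml (inv_antipode_corepl _ _ vU) (negPf ql).
by rewrite mul0r scaler0.
Qed.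

Lemma convr_mull a x :
  convr (integral_mull a) x = S (convr (integral_mulr x) a).
Proof.
have linA x' : linear (fun a' => convr (integral_mull a') x').
  move=> c y z; rewrite /convr !tensor_liftE scaler_sumr -big_split.
  apply: eq_bigr => p _ /=.
  by rewrite mulrDl -scalerAl linearP /= scalerDl scalerA.
have linX a' : linear (fun x' => S (convr (integral_mulr x') a')).
  move=> c y z; rewrite -linearP; congr (S _).
  rewrite /convr !tensor_liftE scaler_sumr -big_split; apply: eq_bigr => p _ /=.
  by rewrite mulrDr -scalerAr linearP /= scalerDl scalerA.
move: a; apply: (corep_ind FI Finv) => [|n v [vC _] k l].
  apply: lin_closed_eq => // c y z.
  by rewrite !linearP.
move: x; apply: (corep_ind FI Finv) => [|m u [uC _] i j].
  by apply: lin_closed_eq => // c y z; rewrite linearP.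
rewrite !convr_corep // linear_sum /=.
transitivity (\sum_p S (v k p) * (phi (v p l * u i j))%:A); last first.
  by apply: eq_bigr => p _; rewrite linearZ mulr_algr.
transitivity (\sum_p \sum_q \sum_m0
    phi (v q l * u m0 j) *: (S (v k p) * v p q * u i m0)); last first.
  apply: eq_bigr => p _; rewrite -convr_integral /convr (comulM_corep _ _ _ _ vC uC).
  rewrite (big_morph _ (tensor_liftD (balanced_convr phi H))
    (tensor_lift0 (balanced_convr phi H))) mulr_sumr; apply: eq_bigr => q _.
  rewrite tensor_lift_sum ?mulr_sumr; last exact: balanced_convr.
  by apply: eq_bigr => m0 _; rewrite -scalerAr mulrA.
rewrite exchange_big /= (bigD1 k) //= [X in _ + X]big1 ?addr0.
  rewrite exchange_big /=; apply: eq_bigr => m0 _.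
  by rewrite -scaler_sumr -mulr_suml antipode_corepl // eqxx mul1r.
move=> q qk; rewrite exchange_big big1 //= => m0 _.
rewrite -scaler_sumr -mulr_suml antipode_corepl // eq_sym (negPf qk).
by rewrite mul0r scaler0.
Qed.

Lemma convl_mulr b x :
  convl (integral_mulr b) x = S (convl (integral_mull x) b).
Proof. by rewrite convl_mull (inv_antipodeK FI Finv). Qed.

Lemma convr_mulr b x :
  convr (integral_mulr b) x = Si (convr (integral_mull x) b).
Proof. by rewrite convr_mull (antipodeK FI Finv). Qed.

End NormalIntegral.

(** * Positivity of the form defined by the normal integral *)

Section Positivity.
Local Open Scope sesquilinear_scope.
Variables (C : numClosedFieldType) (H : circHopfAlgType C).
Variables (F : H -> H -> C).
Hypothesis FI : is_inner F.
Hypothesis Finv : forall u v : H,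
  tensor_lift (fun u0 u1 => F u0 v *: u1) (comul u)
  = tensor_lift (fun v0 v1 => F u v0 *: circ v1) (comul v).
Variable phi : {scalar H}.
Hypothesis phiN : normal_integral phi.
Local Notation S := (antipode : {linear H -> H}).
Local Notation Si := (@inv_antipode C H).
Local Notation ip := (inner_product phi).

Lemma star_sum (I : Type) (r : seq I) (P : pred I) (a : I -> C) (x : I -> H) :
  star (\sum_(i <- r | P i) a i *: x i)
  = \sum_(i <- r | P i) (a i)^* *: star (x i).
Proof.
have starD (y z : H) : star (y + z) = star y + star z.
  by have := starP 1 y z; rewrite rmorph1 !scale1r.
rewrite (big_morph _ starD (star0 H)); apply: eq_bigr => i _.
by have := starP (a i) (x i) 0; rewrite star0 !addr0.
Qed.

Lemma inner_product_sum m n (a : 'I_m -> C) (x : 'I_m -> H) (b : 'I_n -> C) (y : 'I_n -> H) :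
  ip (\sum_i a i *: x i) (\sum_j b j *: y j)
  = \sum_i \sum_j a i * (b j)^* * ip (x i) (y j).
Proof.
rewrite inner_productE star_sum mulr_sumr linear_sum; apply: eq_bigr => i _.
rewrite mulr_suml linear_sum; apply: eq_bigr => j _.
by rewrite -scalerAl -scalerAr !linearZ /= mulrA [_ * a i]mulrC.
Qed.

Lemma comul_star_basis n (e : 'I_n -> H) (u : 'I_n -> 'I_n -> H) j :
  unitary_corep u -> (forall j, comul (e j) = \sum_i e i \ox u i j) ->
  comul (star (e j)) = \sum_k star (e k) \ox S (u j k).
Proof.
move=> [uC uU] eD.
have starE i : star (e i) = \sum_k (counit (e k))^* *: S (u i k).
  rewrite [e i](comodule_basis_counit i eD) star_sum; apply: eq_bigr => k _.
  by rewrite /star uU.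
rewrite starE linear_sum; under [RHS]eq_bigr => k _ do rewrite starE tens_suml.
rewrite exchange_big; apply: eq_bigr => i _ /=.
rewrite linearZ /= (proj1 (antipode_corep uC)) scaler_sumr.
by apply: eq_bigr => k _; rewrite tens_scalel.
Qed.

(** Strong invariance at [star (e i)] and [e j]. When the Gram matrix is diagonal, this kills the
    entries of [u] between different eigenvalues. *)
Lemma gram_intertwiner n (e : 'I_n -> H) (u : 'I_n -> 'I_n -> H) i j :
  unitary_corep u -> (forall j, comul (e j) = \sum_i e i \ox u i j) ->
  \sum_k ip (e k) (e i) *: u k j = \sum_k ip (e j) (e k) *: u i k.
Proof.
move=> uU eD; have := convl_mull FI Finv phiN (star (e i)) (e j).
rewrite /convl (comul_star_basis i uU eD) eD.
rewrite tensor_lift_sum; last exact: (balanced_convl (integral_mull phi _) H).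
rewrite tensor_lift_sum; last exact: (balanced_convl (integral_mulr phi _) H).
move=> ->; rewrite linear_sum; apply: eq_bigr => k _.
by rewrite linearZ /= (antipodeK FI Finv).
Qed.

(* If the Gram matrix is diagonal, the vectors of one of its eigenspaces span a
   comodule.  For an orthonormal basis g of the comodule spanned by their
   adjoints, the sum of the g * g^* is the positive scalar sum |counit g|^2,
   whose integral is a nonnegative multiple of the eigenvalue. *)
Lemma diagonal_gram_gt0 n (e : 'I_n -> H) (u : 'I_n -> 'I_n -> H)
    (lambda : 'I_n -> C) j :
  unitary_corep u -> (forall j, comul (e j) = \sum_i e i \ox u i j) ->
  orthonormal_family F e ->
  (forall i k, ip (e i) (e k) = (i == k)%:R * lambda i) -> 0 < lambda j.
Proof.
move=> uU eD eON eip.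
have ulam i k : lambda i != lambda k -> u i k = 0.
  move=> ik; have := gram_intertwiner i k uU eD.
  rewrite (bigD1 i) //= eip eqxx mul1r big1 ?addr0; last first.
    by move=> l /negPf li; rewrite eip li mul0r scale0r.
  rewrite (bigD1 k) //= eip eqxx mul1r big1 ?addr0; last first.
    by move=> l; rewrite eip eq_sym => /negPf ->; rewrite mul0r scale0r.
  move/eqP; rewrite -subr_eq0 -scalerBl scaler_eq0 subr_eq0 (negPf ik) /=.
  by move/eqP.
pose J i := lambda i == lambda j.
(* Vectors outside the chosen eigenspace become 0, which keeps the index type ['I_n]; thanks to
   [ulam] the coaction formula survives. *)
pose a i := if J i then star (e i) else 0.
have aD i : comul (a i) = \sum_k a k \ox S (u i k).
  rewrite /a; case: ifPn => Ji.
    rewrite (comul_star_basis i uU eD); apply: eq_bigr => k _.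
    case: ifPn => // Jk; rewrite ulam ?linear0.
      by rewrite !tens0r.
    by move: Jk; rewrite /J -(eqP Ji) eq_sym.
  rewrite linear0 big1 // => k _; case: ifPn => Jk; last first.
    by rewrite tens0l.
  rewrite ulam ?linear0 ?tens0r //.
  by move: Ji; rewrite /J -(eqP Jk).
have [m [g [r [gON rU gD aS gP]]]] := comodule_orthonormal_basis FI Finv aD.
have /choice[B BE] i : exists b : 'I_n -> C, g i = \sum_k b k *: a k.
  move: i; apply: (gP (fun z => exists b : 'I_n -> C, z = \sum_k b k *: a k)).
    split=> [|c x y [b ->] [b' ->]].
      by exists (fun=> 0); rewrite big1 // => k _; rewrite scale0r.
    exists (fun k => c * b k + b' k); rewrite scaler_sumr -big_split.
    by apply: eq_bigr => k _; rewrite /= scalerA -scalerDl.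
  move=> k; exists (fun k' => (k' == k)%:R); rewrite (bigD1 k) //= eqxx scale1r.
  by rewrite big1 ?addr0 // => k' /negPf ->; rewrite scale0r.
have rC := proj1 rU.
pose kappa := \sum_i counit (g i) * (counit (g i))^*.
pose tau := \sum_i \sum_k (if J k then B i k * (B i k)^* else 0).
have gg : \sum_i g i * star (g i) = kappa%:A.
  transitivity (\sum_i \sum_k \sum_l
      (counit (g k) * (counit (g l))^*) *: (r k i * S (r i l))).
    apply: eq_bigr => i _; rewrite {2}[g i](comodule_basis_counit i gD) star_sum.
    rewrite {1}[g i](comodule_basis_counit i gD) mulr_suml; apply: eq_bigr => k _.
    rewrite mulr_sumr; apply: eq_bigr => l _.
    by rewrite -scalerAl -scalerAr scalerA /star (proj2 rU).
  rewrite exchange_big scaler_suml; apply: eq_bigr => k _ /=.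
  rewrite exchange_big (bigD1 k) //= [X in _ + X]big1 ?addr0; last first.
    move=> l lk; rewrite -scaler_sumr antipode_corepr //.
    by rewrite eq_sym (negPf lk) scaler0.
  by rewrite -scaler_sumr antipode_corepr // eqxx.
have kt : kappa = lambda j * tau.
  have := congr1 phi gg; rewrite linearZ /= (normal_integral1 phiN) mulr1 => <-.
  rewrite linear_sum mulr_sumr; apply: eq_bigr => i _.
  rewrite {1}BE {1}BE star_sum mulr_suml linear_sum mulr_sumr.
  apply: eq_bigr => k _; rewrite -scalerAl linearZ mulr_sumr linear_sum /=.
  rewrite {1}/a; case: ifPn => Jk; last first.
    by rewrite big1 ?mulr0 // => l _; rewrite mul0r linear0.
  rewrite (bigD1 k) //= big1 ?addr0 => [|l lk].
    rewrite /a Jk (starK FI Finv) -scalerAr linearZ -inner_productE eip eqxx mul1r /=.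
    by rewrite (eqP Jk) mulrA mulrC.
  rewrite /a; case: ifPn => Jl; last by rewrite star0 scaler0 mulr0 linear0.
  by rewrite (starK FI Finv) -scalerAr linearZ -inner_productE eip (negPf lk) mul0r /= mulr0.
have kappa0 : 0 < kappa.
  rewrite lt0r; apply/andP; split; last first.
    by apply: sumr_ge0 => i _; apply: mul_conjC_ge0.
  apply/eqP => k0.
  have g0 i : counit (g i) = 0.
    have /eqP := k0; rewrite psumr_eq0 => [/allP/(_ i)|k _]; last first.
      exact: mul_conjC_ge0.
    by rewrite mem_index_enum mul_conjC_eq0 => /(_ isT)/eqP.
  have gg0 i : g i = 0.
    by rewrite (comodule_basis_counit i gD) big1 // => k _; rewrite g0 scale0r.
  have : a j != 0.
    rewrite /a /J eqxx (star_eq0 FI Finv); apply/eqP => ej.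
    have := eON j j; rewrite ej inner0l // eqxx => /esym/eqP.
    by rewrite oner_eq0.
  by rewrite (aS j) big1 ?eqxx // => k _; rewrite gg0 scaler0.
have tau0 : 0 <= tau.
  apply: sumr_ge0 => i _; apply: sumr_ge0 => k _; case: ifP => // _.
  exact: mul_conjC_ge0.
move: kappa0; rewrite kt; move: tau0; rewrite le_eqVlt => /predU1P[<-|tau0].
  by rewrite mulr0 ltxx.
by rewrite pmulr_lgt0.
Qed.

(** The Gram matrix of a comodule basis is hermitian, hence diagonalized by a unitary [P]. The
    rotated basis is still orthonormal for [F], so [diagonal_gram_gt0] makes every eigenvalue
    positive. *)
Lemma inner_product_gt0 x : x != 0 -> 0 < ip x x.
Proof.
move=> x0; have [n [e [u [eON uU eD xe _]]]] := unitary_corep_basis FI Finv x.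
pose G : 'M[C]_n := \matrix_(i, j) ip (e i) (e j).
have Gh : G \is hermsymmx.
  apply/is_hermitianmxP; rewrite expr0 scale1r; apply/matrixP => i j.
  by rewrite !mxE (inner_product_conj FI Finv phiN).
have /hermitian_normalmx/orthomx_spectralP GE := Gh.
set P := spectralmx G in GE; have PU : P \is unitarymx := spectral_unitarymx G.
have Punit : P \in unitmx := spectral_unit G.
pose lambda i := spectral_diag G 0 i.
have PGP : P *m G *m P^t* = diag_mx (spectral_diag G).
  by rewrite -invmx_unitary // {1}GE !mulmxA mulmxV // mul1mx mulmxK.
have PP : P *m P^t* = 1%:M by apply/unitarymxP.
have PP' : P^t* *m P = 1%:M by rewrite -invmx_unitary // mulVmx.
pose e' i := \sum_k P i k *: e k.
have e'ON : orthonormal_family F e'.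
  move=> i j; have /matrixP/(_ i j) := PP; rewrite !mxE => <-.
  rewrite inner_suml //; apply: eq_bigr => k _; rewrite inner_sumr // !mxE.
  congr (_ * _); rewrite (bigD1 k) //= eON eqxx mulr1 big1 ?addr0 // => l.
  by rewrite eON eq_sym => /negPf ->; rewrite mulr0.
have ee' k : e k = \sum_i (P i k)^* *: e' i.
  rewrite /e'; under eq_bigr => i _ do rewrite scaler_sumr.
  rewrite exchange_big /= (bigD1 k) //= [X in _ + X]big1 ?addr0 => [|l lk].
    under eq_bigr => i _ do rewrite scalerA.
    rewrite -scaler_suml; have /matrixP/(_ k k) := PP'; rewrite !mxE eqxx => PPk.
    rewrite (eq_bigr (fun i => P^t* k i * P i k)) ?PPk ?scale1r // => i _.
    by rewrite !mxE.
  under eq_bigr => i _ do rewrite scalerA.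
  rewrite -scaler_suml; have /matrixP/(_ k l) := PP'.
  rewrite !mxE eq_sym (negPf lk) => PPk.
  rewrite (eq_bigr (fun i => P^t* k i * P i l)) ?PPk ?scale0r // => i _.
  by rewrite !mxE.
have e'S k : in_span_on F e' (e k).
  by rewrite [X in in_span_on _ _ X]ee'; apply: in_span_comb.
have e'P (Q : H -> Prop) : lin_closed Q -> (forall j, Q (e j)) -> forall i, Q (e' i).
  by move=> Ql Qe i; apply: lin_closed_sum.
have [u'U e'D] := comodule_change_basis FI Finv eD e'ON e'S e'P.
have e'ip i k : ip (e' i) (e' k) = (i == k)%:R * lambda i.
  rewrite inner_product_sum; have /matrixP/(_ i k) := PGP.
  rewrite !mxE mulr_natl => <-; rewrite exchange_big /=; apply: eq_bigr => l _.
  rewrite !mxE mulr_suml; apply: eq_bigr => l' _; rewrite mxE.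
  by rewrite -!mulrA; congr (_ * _); rewrite mulrC.
have lambda0 i : 0 < lambda i := diagonal_gram_gt0 i u'U e'D e'ON e'ip.
have xe' : x = \sum_i F x (e' i) *: e' i.
  have Ql : lin_closed (in_span_on F e').
    split; last exact: in_spanP.
    by rewrite /in_span_on big1 // => i _; rewrite inner0l // scale0r.
  by have := lin_closed_sum (index_enum 'I_n) (fun i => F x (e i)) Ql
    (fun i (_ : xpredT i) => e'S i); rewrite -xe.
have xip : ip x x = \sum_i F x (e' i) * (F x (e' i))^* * lambda i.
  rewrite {1 2}xe' inner_product_sum; apply: eq_bigr => i _.
  rewrite (bigD1 i) //= e'ip eqxx mul1r big1 ?addr0 // => k.
  by rewrite e'ip eq_sym => /negPf ->; rewrite mul0r mulr0.
have xge i : 0 <= F x (e' i) * (F x (e' i))^* * lambda i.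
  by rewrite mulr_ge0 ?mul_conjC_ge0 // ltW.
rewrite lt0r xip sumr_ge0 // andbT; apply: contra x0.
rewrite psumr_eq0 // => /allP x0; rewrite xe' big1 // => i _.
have := x0 i (mem_index_enum _); rewrite mulf_eq0 (gt_eqF (lambda0 i)) orbF.
by rewrite mul_conjC_eq0 => /eqP ->; rewrite scale0r.
Qed.

Lemma inner_product_is_inner : is_inner ip.
Proof.
split; [exact: inner_product_scalar| |exact: inner_product_gt0].
exact: (inner_product_conj FI Finv phiN).
Qed.

End Positivity.

(** * The modular function and its fourth root *)

Section ConvolutionOperators.
Variables (K : comNzRingType) (V : coalgType K).
Implicit Types (g h : {scalar V}) (x : V).

Lemma scalar_convl g h x : g (convl h x) = conv h g x.
Proof.
rewrite /convl /conv !tensor_liftE linear_sum; apply: eq_bigr => p _.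
by rewrite linearZ.
Qed.

Lemma scalar_convr g h x : g (convr h x) = conv g h x.
Proof.
rewrite /convr /conv !tensor_liftE linear_sum; apply: eq_bigr => p _.
by rewrite linearZ mulrC.
Qed.

Lemma eq_convl (f f' : V -> K) x : f =1 f' -> convl f x = convl f' x.
Proof. by move=> ff'; apply: eq_tensor_lift => v w; rewrite ff'. Qed.

Lemma eq_convr (f f' : V -> K) x : f =1 f' -> convr f x = convr f' x.
Proof. by move=> ff'; apply: eq_tensor_lift => v w; rewrite ff'. Qed.

Lemma eq_conv (f f' k k' : V -> K) x : f =1 f' -> k =1 k' ->
  conv f k x = conv f' k' x.
Proof. by move=> ff' kk'; apply: eq_tensor_lift => v w; rewrite ff' kk'. Qed.

Lemma convl_comp g h x : convl g (convl h x) = convl (conv h g) x.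
Proof.
rewrite {1}/convl comul_convl [X in tensor_lift _ X]tensor_liftE.
rewrite tensor_lift_sum; last exact: balanced_convl.
by rewrite [RHS]tensor_liftE; apply: eq_bigr => p _; rewrite scalar_convl.
Qed.

Lemma convr_comp g h x : convr g (convr h x) = convr (conv g h) x.
Proof.
rewrite {1}/convr comul_convr [X in tensor_lift _ X]tensor_liftE.
rewrite tensor_lift_sum; last exact: balanced_convr.
by rewrite [RHS]tensor_liftE; apply: eq_bigr => p _; rewrite scalar_convr.
Qed.

Lemma convl_counit x : convl counit x = x. Proof. exact: counitl. Qed.
Lemma convr_counit x : convr counit x = x. Proof. exact: counitr. Qed.

Lemma convX2 g : convX g 2 =1 conv g g.
Proof.
move=> x; apply: eq_conv => // y; rewrite -[RHS]counit_convl.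
by rewrite [RHS]scalar_convl.
Qed.

Lemma convX_counit g n x : convX g n x = counit (iter n (convl g) x).
Proof.
elim: n x => // n IH x.
have ks : scalar (fun y => counit (iter n (convl g) y)).
  by move=> a y z; rewrite iter_linear linearP.
rewrite iterSr -[RHS]/(pack_scalar ks (convl g x)) scalar_convl.
exact: eq_conv.
Qed.

(** Local finiteness of [g ⋆ id]: all iterates at [x] stay in the span of the right legs of one
    fixed expression of [comul x]. *)
Lemma iter_convl_comul g n x m (a b : 'I_m -> V) :
  comul x = \sum_i a i \ox b i ->
  iter n (convl g) x = \sum_i counit (iter n (convl g) (a i)) *: b i.
Proof.
move=> xE; have nE : comul (iter n (convl g) x) = \sum_i iter n (convl g) (a i) \ox b i.
  elim: n => //= n IH; rewrite comul_convl IH tensor_lift_sum //.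
  apply: balanced_bilinear => [w c y z|v]; last exact: linear_tensr.
  by rewrite linearP linear_tensl.
by rewrite -[LHS]counitl nE tensor_lift_sum //; exact: balanced_convl.
Qed.

End ConvolutionOperators.

(** With [d = P x - Q x], commutation gives [P d + Q d = 0]; then [<P d, d>] and [<Q d, d>], both
    positive unless [d = 0], add up to 0. *)
Lemma positive_sqrt_uniq (C : numClosedFieldType) (V : lmodType C)
    (f : V -> V -> C) (P Q : {linear V -> V}) : is_inner f ->
  (forall x, x != 0 -> 0 < f (P x) x) -> (forall x, x != 0 -> 0 < f (Q x) x) ->
  (forall x, P (Q x) = Q (P x)) -> (forall x, P (P x) = Q (Q x)) -> P =1 Q.
Proof.
move=> fI P0 Q0 PQ PPQQ x; apply/eqP; rewrite -subr_eq0; set d := P x - Q x.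
case: eqVneq => // d0; have := addr_gt0 (P0 d d0) (Q0 d d0).
rewrite -(innerDl fI) /d !linearB PPQQ PQ addrA subrK subrr.
by rewrite (inner0l fI) ltxx.
Qed.

(** * The Nakayama automorphism and the operator [alpha ⋆ id] *)

Section ModularFunction.
Variables (C : numClosedFieldType) (H : circHopfAlgType C).
Variables (F : H -> H -> C).
Hypothesis FI : is_inner F.
Hypothesis Finv : forall u v : H,
  tensor_lift (fun u0 u1 => F u0 v *: u1) (comul u)
  = tensor_lift (fun v0 v1 => F u v0 *: circ v1) (comul v).
Variables (phi : {scalar H}) (Sp N : {lrmorphism H -> H}).
Hypothesis phiN : normal_integral phi.
Hypothesis SpP : positive_antipode phi Sp.
Hypothesis NP : nakayama_automorphism phi N.
Local Notation S := (antipode : {linear H -> H}).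
Local Notation Si := (@inv_antipode C H).
Local Notation ip := (inner_product phi).
Let ipI : is_inner ip := inner_product_is_inner FI Finv phiN.
Let SK := antipodeK FI Finv.
Let SiK := inv_antipodeK FI Finv.

(** In general the counit is not of the form [phi (z * -)], but it is so on every finite set. This
    is enough to specialize strong invariance. *)
Lemma integral_represents (s : seq H) (g : {scalar H}) :
  exists z, forall y, y \in s -> phi (z * y) = g y.
Proof.
have [n [e [_ es _]]] := gram_schmidt ipI s.
exists (\sum_i g (e i) *: star (e i)) => y /es ye; rewrite [in RHS]ye.
rewrite mulr_suml !linear_sum; apply: eq_bigr => i _.
by rewrite -scalerAl !linearZ /= mulrC.
Qed.

Fact modular_scalar : scalar (modular_function N).
Proof. by move=> a x y; rewrite /modular_function !linearP. Qed.

Definition modular : {scalar H} := pack_scalar modular_scalar.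

Lemma nakayamaE x y : phi (x * y) = phi (y * N x). Proof. by case: NP. Qed.

(** As [phi (a * -) = phi (- * N a)], the two strong invariance formulas compute the same element:
    [S^-1] of a sum over [comul a], and [S] of a sum over [comul (N a)]. When [z] represents the
    counit these sums are [alpha ⋆ id] at [a], and [N a]. *)
Lemma convl_modular a : convl modular a = S (S (N a)).
Proof.
(* The counit is needed at the left legs of [comul (N a)] and at the images under [N] of the left
   legs of [comul a]. *)
have [z zP] := integral_represents
  ([seq p.1 | p <- repr (comul (N a))] ++ [seq N p.1 | p <- repr (comul a)]) counit.
have := convl_mull FI Finv phiN a z.
have -> : convl (integral_mull phi a) z = convl (integral_mulr phi (N a)) z.
  by apply: eq_convl => x; exact: nakayamaE.
rewrite (convl_mulr FI Finv phiN) => /(congr1 S); rewrite SiK.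
have -> : convl (integral_mull phi z) (N a) = N a.
  rewrite -[RHS]convl_counit /convl !tensor_liftE; apply: eq_big_seq => p ps.
  by congr (_ *: _); apply: zP; rewrite mem_cat map_f.
move=> ->; rewrite /convl !tensor_liftE; apply: eq_big_seq => p ps.
congr (_ *: _); rewrite /= /modular_function -zP.
  by rewrite -nakayamaE.
by rewrite mem_cat (map_f (fun p => N p.1)) ?orbT.
Qed.

Lemma convr_modular a : convr modular a = Si (Si (N a)).
Proof.
have [z zP] := integral_represents
  ([seq p.2 | p <- repr (comul (N a))] ++ [seq N p.2 | p <- repr (comul a)]) counit.
have := convr_mull FI Finv phiN a z.
have -> : convr (integral_mull phi a) z = convr (integral_mulr phi (N a)) z.
  by apply: eq_convr => x; exact: nakayamaE.
rewrite (convr_mulr FI Finv phiN) => /(congr1 Si); rewrite SK.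
have -> : convr (integral_mull phi z) (N a) = N a.
  rewrite -[RHS]convr_counit /convr !tensor_liftE; apply: eq_big_seq => p ps.
  by congr (_ *: _); apply: zP; rewrite mem_cat map_f.
move=> ->; rewrite /convr !tensor_liftE; apply: eq_big_seq => p ps.
congr (_ *: _); rewrite /= /modular_function -zP.
  by rewrite -nakayamaE.
by rewrite mem_cat (map_f (fun p => N p.2)) ?orbT.
Qed.

Lemma Sp_inj : injective Sp. Proof. by case: SpP => /bij_inj. Qed.

Lemma comul_Sp x : comul (Sp x) = tensor_lift (fun a b => Sp a \ox Sp b) (comul x).
Proof. by case: SpP => _ [->]. Qed.

Lemma balanced_Sp : balanced (fun a b : H => Sp a \ox Sp b).
Proof.
apply: balanced_bilinear => [w c y z|v c y z].
  by rewrite linearP linear_tensl.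
by rewrite linearP linear_tensr.
Qed.

Lemma counit_Sp x : counit (Sp x) = counit x.
Proof. by case: SpP => _ [_ ->]. Qed.

Lemma Sp_selfadjoint x y : ip (Sp x) y = ip x (Sp y).
Proof. by case: SpP => _ _ [->]. Qed.

Lemma Sp_sqr x : Sp (Sp x) = S (S x). Proof. by case: SpP. Qed.

Lemma Sp_eq0 x : (Sp x == 0) = (x == 0).
Proof. exact: raddf_eq0 Sp_inj. Qed.

Lemma convr_Sp (g : {scalar H}) : (forall x, g (Sp x) = g x) ->
  forall x, convr g (Sp x) = Sp (convr g x).
Proof.
move=> gSp x; rewrite {1}/convr comul_Sp [X in tensor_lift _ X]tensor_liftE.
rewrite tensor_lift_sum.
  rewrite /convr tensor_liftE linear_sum; apply: eq_bigr => p _.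
  by rewrite linearZ /= gSp.
exact: balanced_convr.
Qed.

Lemma integral_Sp x : phi (Sp x) = phi x.
Proof.
have fs : scalar (phi \o Sp) by move=> a y z /=; rewrite !linearP.
apply: (integral_uniq FI Finv phiN (f := pack_scalar fs)) => [y|]; last first.
  by rewrite /= rmorph1 (normal_integral1 phiN).
apply: Sp_inj; rewrite linearZ /= rmorph1 -(convl_integral FI Finv phiN).
rewrite [in RHS]/convl comul_Sp [X in tensor_lift _ X]tensor_liftE tensor_lift_sum.
  rewrite /convl tensor_liftE linear_sum; apply: eq_bigr => p _.
  by rewrite linearZ.
exact: balanced_convl.
Qed.

Lemma integral_nondegenerate x y : (forall z, phi (z * x) = phi (z * y)) -> x = y.
Proof. by move=> xy; apply: (inner_eq ipI) => z; rewrite !inner_productE. Qed.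

(** [S_+] is an algebra automorphism preserving [phi], so it commutes with the automorphism that
    [phi] determines. *)
Lemma nakayama_Sp x : N (Sp x) = Sp (N x).
Proof.
apply: integral_nondegenerate => z; have [[Sp' SpK SpK'] _ _ _] := SpP.
rewrite -nakayamaE -[z]SpK' -!rmorphM !integral_Sp.
by rewrite nakayamaE.
Qed.

Lemma nakayama_antipode2 x : N (S (S x)) = S (S (N x)).
Proof. by rewrite -!Sp_sqr !nakayama_Sp. Qed.

Lemma inner_product_nakayama x y : ip (N x) y = ip (star y) (star x).
Proof. by rewrite !inner_productE -nakayamaE (starK FI Finv). Qed.

Lemma nakayama_selfadjoint x y : ip (N x) y = ip x (N y).
Proof. by rewrite [RHS](innerC ipI) !inner_product_nakayama -(innerC ipI). Qed.

Lemma modular_selfadjoint x y : ip (convl modular x) y = ip x (convl modular y).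
Proof.
rewrite !convl_modular -!Sp_sqr Sp_selfadjoint -nakayama_Sp nakayama_selfadjoint.
by rewrite Sp_selfadjoint nakayama_Sp.
Qed.

Lemma modular_gt0 x : x != 0 -> 0 < ip (convl modular x) x.
Proof.
move=> x0; rewrite convl_modular -Sp_sqr Sp_selfadjoint -nakayama_Sp inner_product_nakayama.
by apply: (inner_gt0 ipI); rewrite (star_eq0 FI Finv) Sp_eq0.
Qed.

Lemma modular_decomp x :
  exists2 s, eigen_list (convl modular) s & x = \sum_(q <- s) q.2.
Proof.
have [n [b [_ xE]]] := comul_orthonormal_right FI x.
(* One iterate more than there are right legs, which forces a linear relation. *)
pose y (k : 'I_n.+1) := iter k (convl modular) x.
have yE k := iter_convl_comul modular k xE.
have [r r0 rx] := linear_dependence (ltnSn n) (fun k : 'I_n.+1 => yE k).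
exact: (iter_dependent_decomp ipI modular_selfadjoint modular_gt0 r0 rx).
Qed.

End ModularFunction.

(** * Characters and their convolution inverses *)

Section Characters.
Variables (C : numClosedFieldType) (H : circHopfAlgType C).
Variables (F : H -> H -> C).
Hypothesis FI : is_inner F.
Hypothesis Finv : forall u v : H,
  tensor_lift (fun u0 u1 => F u0 v *: u1) (comul u)
  = tensor_lift (fun v0 v1 => F u v0 *: circ v1) (comul v).
Local Notation S := (antipode : {linear H -> H}).
Variable chi : {scalar H}.
Hypotheses (chiM : {morph chi : x y / x * y}) (chi1 : chi 1 = 1).

Definition inv_character : {scalar H} := pack_scalar (linearP (chi \o S)).

Lemma conv_character_inv : conv_inverse chi inv_character.
Proof.
split=> x.
- have := congr1 chi (antipoder x); rewrite linearZ /= chi1 mulr1 => <-.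
  by rewrite /conv !tensor_liftE linear_sum; apply: eq_bigr => p _; rewrite chiM.
- have := congr1 chi (antipodel x); rewrite linearZ /= chi1 mulr1 => <-.
  by rewrite /conv !tensor_liftE linear_sum; apply: eq_bigr => p _; rewrite chiM.
Qed.

(** [S] exchanges the legs and the inverse character is [chi ∘ S]. Through this identity
    [id ⋆ chi^-1] inherits properties of [chi ⋆ id]. *)
Lemma antipode_convr_inv x : S (convr inv_character x) = convl chi (S x).
Proof.
move: x; apply: (eq_on_coreps FI Finv (L := S \o convr inv_character)
  (M := convl chi \o S)) => n u [uC _] i j /=.
rewrite (convl_corep chi j i (antipode_corep uC)) convr_corep // linear_sum.
by apply: eq_bigr => k _; rewrite linearZ.
Qed.

Lemma convr_inv_K x : convr chi (convr inv_character x) = x.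
Proof.
rewrite convr_comp -[RHS]convr_counit; apply: eq_convr.
exact: (proj1 conv_character_inv).
Qed.

End Characters.

(** * The fourth root and its comparison with the positive antipode *)

Section PositiveRoot.
Variables (C : numClosedFieldType) (H : circHopfAlgType C).
Variables (F : H -> H -> C).
Hypothesis FI : is_inner F.
Hypothesis Finv : forall u v : H,
  tensor_lift (fun u0 u1 => F u0 v *: u1) (comul u)
  = tensor_lift (fun v0 v1 => F u v0 *: circ v1) (comul v).
Variables (phi : {scalar H}) (Sp N : {lrmorphism H -> H}).
Hypothesis phiN : normal_integral phi.
Hypothesis SpP : positive_antipode phi Sp.
Hypothesis NP : nakayama_automorphism phi N.
Local Notation S := (antipode : {linear H -> H}).
Local Notation Si := (@inv_antipode C H).
Local Notation ip := (inner_product phi).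
Local Notation alpha := (modular N).
Let ipI : is_inner ip := inner_product_is_inner FI Finv phiN.
Let SK := antipodeK FI Finv.
Let SiK := inv_antipodeK FI Finv.
Let Tsa := modular_selfadjoint FI Finv phiN SpP NP.
Let Tpos := modular_gt0 FI Finv phiN SpP NP.
Let dec := modular_decomp FI Finv phiN SpP NP.

Definition modular_calc (g : C -> C) : {linear H -> H} :=
  pack_linear (fun_calc_linear ipI Tsa dec g).
Local Notation fc := modular_calc.

Lemma modular_calc_eigen g a v : 0 < a -> convl alpha v = a *: v -> fc g v = g a *: v.
Proof. exact: (fun_calc_eigen ipI Tsa). Qed.

Lemma modular_calc_comp g h x : fc g (fc h x) = fc (fun a => g a * h a) x.
Proof. exact: (fun_calc_comp ipI Tsa). Qed.

Lemma eq_modular_calc g h x : (forall a, 0 < a -> g a = h a) -> fc g x = fc h x.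
Proof. by move=> gh; apply: (fun_calc_ext ipI Tsa). Qed.

Lemma modular_calc_comm g (L : {linear H -> H}) :
  (forall x, convl alpha (L x) = L (convl alpha x)) ->
  forall x, fc g (L x) = L (fc g x).
Proof. exact: (fun_calc_comm ipI Tsa). Qed.

Lemma modular_calc_selfadjoint g : (forall a, 0 < a -> 0 < g a) ->
  forall x y, ip (fc g x) y = ip x (fc g y).
Proof.
by move=> g0; apply: (fun_calc_selfadjoint ipI Tsa) => a /g0/gtr0_real.
Qed.

Lemma modular_calc_eq0 g : (forall a, 0 < a -> 0 < g a) -> forall x, fc g x = 0 -> x = 0.
Proof.
by move=> g0; apply: (fun_calc_inj ipI Tsa) => a /g0/lt0r_neq0.
Qed.

Lemma modular_mul x y : convl alpha (x * y) = convl alpha x * convl alpha y.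
Proof.
by rewrite !(convl_modular FI Finv phiN NP) rmorphM !(antipodeM FI Finv).
Qed.

Lemma modular1 : convl alpha 1 = 1.
Proof. by rewrite (convl_modular FI Finv phiN NP) rmorph1 !antipode1. Qed.

Lemma modular_calc_mul g : (forall a b, 0 < a -> 0 < b -> g (a * b) = g a * g b) ->
  forall x y, fc g (x * y) = fc g x * fc g y.
Proof.
move=> gM x y; move: x; apply: (eigen_ind dec) => [|x x' IH IH'|a u a0 Tu].
- by rewrite mul0r linear0 mul0r.
- by rewrite mulrDl !linearD /= IH IH' mulrDl.
move: y; apply: (eigen_ind dec) => [|y y' IH IH'|b v b0 Tv].
- by rewrite mulr0 linear0 mulr0.
- by rewrite mulrDr !linearD /= IH IH' mulrDr.
rewrite (modular_calc_eigen _ a0 Tu) (modular_calc_eigen _ b0 Tv).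
rewrite (@modular_calc_eigen g (a * b)) ?mulr_gt0 //.
  by rewrite gM // -scalerAl -scalerAr scalerA.
by rewrite modular_mul Tu Tv -scalerAl -scalerAr scalerA.
Qed.

(** An operator [L] commuting with every [id ⋆ f] is determined by its composite with the counit,
    because [f (L x)] is the counit of [L] at [(id ⋆ f) x]. The functionals [<-, z>] separate
    points. *)
Lemma convl_modular_calc g x : convl (pack_scalar (linearP (counit \o fc g))) x = fc g x.
Proof.
apply: (inner_eq ipI) => z.
pose f := pack_scalar (inner_scalar ipI z).
rewrite -[LHS]/(f _) -[RHS]/(f _).
have cr w : f w = counit (convr f w) by rewrite counit_convr.
rewrite scalar_convl [RHS]cr.
have -> : convr f (fc g x) = fc g (convr f x).
  by rewrite (@modular_calc_comm g (convr f)) // => y; rewrite convl_convr_comm.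
rewrite -[RHS]/(pack_scalar (linearP (counit \o fc g)) (convr f x)).
by rewrite -scalar_convl_convr scalar_convl.
Qed.

(** This is [A^(1/4)], written as the square of [A^(1/8)] so that positivity becomes that of a
    square norm. Below, [A^(1/2)] is the fourth power of the same root, and exponents simply add. *)
Definition beta_op := fc (fun a => 8.-root a ^+ 2).

Definition beta : {scalar H} := pack_scalar (linearP (counit \o beta_op)).

Definition betaV : {scalar H} := inv_character beta.

Lemma convl_beta x : convl beta x = beta_op x.
Proof. exact: convl_modular_calc. Qed.

Lemma root8_gt0 (a : C) n : 0 < a -> 0 < 8.-root a ^+ n.
Proof. by move=> a0; rewrite exprn_gt0 // rootC_gt0. Qed.

Lemma beta_op_gt0 x : x != 0 -> 0 < ip (beta_op x) x.
Proof.
apply: (fun_calc_gt0 ipI Tsa dec (g := 8.-root) _ _) => a // a0.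
by rewrite rootC_gt0.
Qed.

Lemma beta_op_selfadjoint x y : ip (beta_op x) y = ip x (beta_op y).
Proof. by apply: modular_calc_selfadjoint => a; apply: root8_gt0. Qed.

Lemma beta_op4 x : beta_op (beta_op (beta_op (beta_op x))) = convl alpha x.
Proof.
rewrite !modular_calc_comp -[RHS](fun_calc_id ipI Tsa dec); apply: eq_modular_calc => a _.
by rewrite -!exprD rootCK.
Qed.

Lemma betaM : {morph beta : x y / x * y}.
Proof.
move=> x y; rewrite -[LHS]/(counit (beta_op _)) modular_calc_mul ?counitM // => a b a0 b0.
by rewrite rootCMl ?exprMn // ltW.
Qed.

Lemma beta1 : beta 1 = 1.
Proof.
rewrite -[LHS]/(counit (beta_op _)) (modular_calc_eigen _ ltr01) ?rootC1 ?expr1n ?scale1r //.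
  exact: counit1.
by rewrite modular1.
Qed.

Lemma beta_op_Sp x : beta_op (Sp x) = Sp (beta_op x).
Proof.
apply: modular_calc_comm => y.
rewrite !(convl_modular FI Finv phiN NP) (nakayama_Sp FI Finv phiN SpP NP).
by rewrite -!(Sp_sqr SpP).
Qed.

Lemma beta_Sp x : beta (Sp x) = beta x.
Proof. by rewrite -[LHS]/(counit (beta_op _)) beta_op_Sp (counit_Sp SpP). Qed.

(** The matrices of [betaV] at [u] and at [Sp u] invert those of [beta] at [u] and at [Sp u], which
    are equal by [beta_Sp]. *)
Lemma betaV_Sp x : betaV (Sp x) = betaV x.
Proof.
have [bV Vb] := conv_character_inv betaM beta1.
have convE (f g : {scalar H}) n (u : 'I_n -> 'I_n -> H) : corep u ->
    (\matrix_(i, j) f (u i j)) *m (\matrix_(i, j) g (u i j))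
    = \matrix_(i, j) conv f g (u i j) :> 'M[C]_n.
  move=> uC; apply/matrixP => i j; rewrite !mxE /conv lift_corep //.
    by apply: eq_bigr => k _; rewrite !mxE.
  apply: (@balanced_bilinear _ _ _ C^o) => [w c y z|v c y z].
    by rewrite linearP /= mulrDl -mulrA.
  by rewrite linearP /= mulrDr mulrCA.
move: x; apply: (corep_ind FI Finv) => [|n u [uC _] i j].
  split=> [|a x y xE yE]; first by rewrite !linear0.
  by rewrite !linearP xE yE.
have SuC : corep (fun i j => Sp (u i j)).
  split=> k l; last by rewrite (counit_Sp SpP); case: uC => _ ->.
  by rewrite (comul_Sp SpP) lift_corep //; exact: balanced_Sp.
have := convE betaV beta n u uC; have := convE beta betaV n _ SuC.
have eqb : \matrix_(i, j) beta (Sp (u i j)) = \matrix_(i, j) beta (u i j) :> 'M_n.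
  by apply/matrixP => k l; rewrite !mxE beta_Sp.
rewrite eqb.
have -> : \matrix_(i, j) conv beta betaV (Sp (u i j)) = 1%:M :> 'M[C]_n.
  by apply/matrixP => k l; rewrite !mxE bV; case: SuC => _ ->.
have -> : \matrix_(i, j) conv betaV beta (u i j) = 1%:M :> 'M[C]_n.
  by apply/matrixP => k l; rewrite !mxE Vb; case: uC => _ ->.
move=> bb' b''b.
have : \matrix_(i, j) betaV (Sp (u i j)) = \matrix_(i, j) betaV (u i j) :> 'M[C]_n.
  by rewrite -[LHS]mul1mx -b''b -mulmxA bb' mulmx1.
by move/matrixP/(_ i j); rewrite !mxE.
Qed.

(** Selfadjointness moves [beta ⋆ id] from [u k l] to [z], and strong invariance brings it back as
    values of [beta ∘ S^2] at entries of [u]; [beta ∘ S^2 = beta] since [S^2] is the square of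
    [S_+]. Nondegeneracy and the counit isolate these values. *)
Lemma beta_circ x : beta x = (beta (circ x))^*.
Proof.
have betaSS y : beta (S (S y)) = beta y by rewrite -(Sp_sqr SpP) !beta_Sp.
move: x; apply: (corep_ind FI Finv) => [|n u uU k l].
  split=> [|a x y xE yE]; first by rewrite !linear0 rmorph0.
  have -> : circ (a *: x + y) = a^* *: circ x + circ y by rewrite linearP.
  by rewrite !(linearP beta) xE yE rmorphD rmorphM /= conjCK.
have [uC uc] := uU; have ue := proj2 uC.
suff : \sum_p (beta (circ (u k p)))^* *: u p l = \sum_p beta (u k p) *: u p l.
  move=> /(congr1 counit); rewrite !linear_sum.
  under eq_bigr => p _ do rewrite linearZ /= ue.
  by under [RHS]eq_bigr => p _ do rewrite linearZ /= ue; rewrite !sum_mul_delta.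
apply: (inner_eq ipI) => z; rewrite !(innerC ipI z); congr (_^*).
have := beta_op_selfadjoint z (u k l); rewrite -!convl_beta [in RHS]convl_corep //.
move=> <-; rewrite inner_sumr //.
transitivity (beta (convr (integral_mull phi (star (u k l))) z)); last first.
  exact: esym (scalar_convl_convr beta (integral_mull phi (star (u k l))) z).
rewrite (convr_mull FI Finv phiN) /star uc.
rewrite (convr_corep _ k l (antipode_corep uC)) !linear_sum.
apply: eq_bigr => p _; have -> c y : beta (S (c *: y)) = c * beta (S y).
  by rewrite [antipode (_ *: _)]linearZ [LHS]linearZ.
by rewrite betaSS conjCK mulrC uc inner_productE /star uc.
Qed.

Definition betaV_op : {linear H -> H} := pack_linear (linearP (convr betaV)).

Lemma antipode_betaV x : S (betaV_op x) = beta_op (S x).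
Proof.
by rewrite -convl_beta -[LHS]/(S (convr betaV x)) (antipode_convr_inv FI Finv beta).
Qed.

(** The left side is [phi (y° * S x)]. Composing with [S] gives [phi (S^2 x * star y)]; exchanging
    the factors costs [N], and [N S^2 = alpha ⋆ id]. *)
Lemma inner_product_antipode x y : ip (S x) (S y) = ip (convl alpha x) y.
Proof.
rewrite inner_productE (star_antipode FI Finv) -(integral_antipode FI Finv phiN).
rewrite (antipodeM FI Finv) (convl_modular FI Finv phiN NP).
by rewrite -(nakayama_antipode2 FI Finv phiN SpP NP) inner_productE -(nakayamaE NP).
Qed.

Lemma betaV_modular x : betaV_op (convl alpha x) = convl alpha (betaV_op x).
Proof. by rewrite -[LHS]/(convr betaV _) -convl_convr_comm. Qed.

Lemma modular_calc_betaV g x : fc g (betaV_op x) = betaV_op (fc g x).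
Proof. by apply: modular_calc_comm => y; rewrite betaV_modular. Qed.

Lemma modular_surj y : exists x, y = convl alpha x.
Proof.
exists (fc (fun a => a^-1) y).
rewrite -(fun_calc_id ipI Tsa dec) -[RHS]/(fc _ _) modular_calc_comp.
rewrite -[LHS](fun_calc1 ipI Tsa dec) -[LHS]/(fc _ _).
by apply: eq_modular_calc => a a0; rewrite mulfV ?gt_eqF.
Qed.

(** Selfadjointness of [beta_op] is pulled back along [S]. Writing [y = A z] supplies the factor [A]
    by which [S] fails to be an isometry. *)
Lemma betaV_op_selfadjoint x y : ip (betaV_op x) y = ip x (betaV_op y).
Proof.
have [z ->] := modular_surj y.
rewrite -Tsa -inner_product_antipode antipode_betaV beta_op_selfadjoint -antipode_betaV.
by rewrite inner_product_antipode Tsa betaV_modular.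
Qed.

Lemma antipode_eq0 x : (S x == 0) = (x == 0).
Proof. exact: (raddf_eq0 _ (can_inj SK)). Qed.

(** With [x = A^(1/2) z], [V] for [betaV_op] and [B] for [beta_op]: [<V x, x> = <A V z, z> = <S V z,
    S z> = <B S z, S z>]. *)
Lemma betaV_op_gt0 x : x != 0 -> 0 < ip (betaV_op x) x.
Proof.
have DV z : fc (fun a => 8.-root a ^+ 4) (fc (fun a => (8.-root a ^+ 4)^-1) z) = z.
  rewrite modular_calc_comp -[RHS](fun_calc1 ipI Tsa dec) -[RHS]/(fc _ _).
  by apply: eq_modular_calc => a a0; rewrite mulfV ?gt_eqF ?root8_gt0.
rewrite -(DV x); set z := fc _ x => Dz.
have z0 : z != 0 by apply: contraNneq Dz => ->; rewrite linear0.
rewrite -modular_calc_betaV -modular_calc_selfadjoint => [|a]; last exact: root8_gt0.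
have D2 y : fc (fun a => 8.-root a ^+ 4) (fc (fun a => 8.-root a ^+ 4) y)
            = convl alpha y.
  rewrite modular_calc_comp -[RHS](fun_calc_id ipI Tsa dec) -[RHS]/(fc _ _).
  by apply: eq_modular_calc => a _; rewrite -exprD rootCK.
by rewrite D2 -inner_product_antipode antipode_betaV beta_op_gt0 // antipode_eq0.
Qed.

Definition beta_conj : {linear H -> H} := pack_linear (linearP (beta_op \o betaV_op)).

Lemma beta_conjE x : beta_conj x = beta_op (betaV_op x). Proof. by []. Qed.

Lemma beta_conj_selfadjoint x y : ip (beta_conj x) y = ip x (beta_conj y).
Proof.
by rewrite !beta_conjE beta_op_selfadjoint betaV_op_selfadjoint modular_calc_betaV.
Qed.

(** [beta_op] is the square of [A^(1/8)], which commutes with [betaV_op]; moving one factor across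
    the form reduces to positivity of [betaV_op]. *)
Lemma beta_conj_gt0 x : x != 0 -> 0 < ip (beta_conj x) x.
Proof.
move=> x0; have E0 (a : C) : 0 < a -> 0 < 8.-root a by rewrite rootC_gt0.
have -> : beta_conj x = fc 8.-root (fc 8.-root (betaV_op x)).
  by rewrite modular_calc_comp; apply: eq_modular_calc.
rewrite modular_calc_selfadjoint // modular_calc_betaV; apply: betaV_op_gt0.
by apply: contraNneq x0 => /modular_calc_eq0 ->.
Qed.

Lemma positive_eq0 (L : {linear H -> H}) :
  (forall x, x != 0 -> 0 < ip (L x) x) -> forall x, x != 0 -> L x != 0.
Proof.
by move=> L0 x /L0; apply: contraTneq => ->; rewrite inner0l // ltxx.
Qed.

(** The fourth powers of the two factors are [alpha ⋆ id = S^2 N] and [id ⋆ alpha^-1]. From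
    [id ⋆ alpha = S^-2 N] it follows that [N (id ⋆ alpha^-1) = S^2]. *)
Lemma beta_conj4 x :
  beta_conj (beta_conj (beta_conj (beta_conj x))) = S (S (S (S x))).
Proof.
have C4 : betaV_op (betaV_op (betaV_op (betaV_op x))) = convr (inv_character alpha) x.
  apply: (can_inj SK); rewrite !antipode_betaV beta_op4.
  by rewrite (antipode_convr_inv FI Finv alpha).
have bv y : betaV_op (beta_op y) = beta_op (betaV_op y) by rewrite [RHS]modular_calc_betaV.
rewrite !beta_conjE !bv C4 beta_op4 (convl_modular FI Finv phiN NP).
suff -> : N (convr (inv_character alpha) x) = S (S x) by [].
have alphaM : {morph alpha : y z / y * z}.
  by move=> y z; rewrite -[LHS]/(counit (N _)) rmorphM counitM.
have alpha1 : alpha 1 = 1 by rewrite -[LHS]/(counit (N 1)) rmorph1 counit1.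
have := convr_inv_K alphaM alpha1 x.
by rewrite (convr_modular FI Finv phiN NP) => {2}<-; rewrite !SiK.
Qed.

Lemma betaV_op_Sp x : betaV_op (Sp x) = Sp (betaV_op x).
Proof. exact: (convr_Sp SpP betaV_Sp). Qed.

Lemma beta_conj_Sp x : beta_conj (Sp x) = Sp (beta_conj x).
Proof. by rewrite !beta_conjE betaV_op_Sp beta_op_Sp. Qed.

Lemma Sp_eq_beta_conj : Sp =1 beta_conj.
Proof.
have Sp0 x : x != 0 -> 0 < ip (Sp x) x by case: SpP => _ _ [_ +] _; apply.
(* The squares are again positive and commute, and their squares are the fourth powers compared in
   [beta_conj4]. *)
have sqE : Sp \o Sp =1 beta_conj \o beta_conj.
  apply: (positive_sqrt_uniq ipI (P := Sp \o Sp) (Q := beta_conj \o beta_conj)) =>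
    [x x0|x x0|x|x].
  - by rewrite /= (Sp_selfadjoint SpP); apply: (inner_gt0 ipI); rewrite (Sp_eq0 SpP).
  - change (0 < ip (beta_conj (beta_conj x)) x).
    rewrite beta_conj_selfadjoint; apply: (inner_gt0 ipI).
    exact: (positive_eq0 beta_conj_gt0).
  - by change (Sp (Sp (beta_conj (beta_conj x))) = beta_conj (beta_conj (Sp (Sp x))));
      rewrite !beta_conj_Sp.
  - change (Sp (Sp (Sp (Sp x))) = beta_conj (beta_conj (beta_conj (beta_conj x)))).
    by rewrite beta_conj4 !(Sp_sqr SpP).
apply: (positive_sqrt_uniq ipI (P := Sp)) => // [x x0|x].
  exact: beta_conj_gt0.
by rewrite beta_conj_Sp.
Qed.

Lemma positive_root_character : exists beta betaV : {scalar H},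
    conv_inverse beta betaV /\
    (forall x, Sp x = convl beta (convr betaV x)) /\
    (forall x, antipode (antipode x)
               = convl (convX beta 2) (convr (convX betaV 2) x)) /\
    (forall x, beta x = beta (Sp x)) /\
    (forall x, betaV x = betaV (Sp x)) /\
    (forall x, beta x = Num.conj (beta (circ x))) /\
    selfadjoint phi (convl beta) /\
    selfadjoint phi (convr betaV) /\
    (forall x, convl beta (convr betaV x) = convr betaV (convl beta x)) /\
    (forall D : {pred H}, simple_subcoalgebra D ->
       {in D, forall x, convl beta x \in D} /\
       {in D, forall x, convr betaV x \in D}) /\
    positive phi (convl beta) /\
    positive phi (convr betaV) /\
    (forall x y, beta (x * y) = beta x * beta y) /\
    beta 1 = 1 /\
    (forall x, convX beta 4 x = modular_function N x).
Proof.
have Bsa : selfadjoint phi (convl beta).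
  by move=> x y; rewrite !convl_beta; apply: beta_op_selfadjoint.
have Vsa : selfadjoint phi (convr betaV) by exact: betaV_op_selfadjoint.
exists beta, betaV; split; first exact: conv_character_inv betaM beta1.
split; first by move=> x; rewrite convl_beta; exact: Sp_eq_beta_conj.
split.
  move=> x; rewrite -(Sp_sqr SpP) !Sp_eq_beta_conj !beta_conjE.
  rewrite (eq_convl _ (convX2 beta)) (eq_convr _ (convX2 betaV)).
  rewrite -convl_comp -convr_comp !convl_beta; congr (beta_op _).
  by rewrite -[LHS]/(betaV_op _) -modular_calc_betaV.
split; first by move=> x; rewrite beta_Sp.
split; first by move=> x; rewrite betaV_Sp.
split; first exact: beta_circ.
split; first exact: Bsa.
split; first exact: Vsa.
split; first by move=> x; apply: convl_convr_comm.
split.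
  move=> D [Ds _ _]; split=> x xD; first exact: subcoalgebra_convl.
  exact: subcoalgebra_convr.
split.
  by split=> // x x0; rewrite convl_beta; apply: beta_op_gt0.
split; first by split=> // x x0; apply: betaV_op_gt0.
split; first exact: betaM.
split; first exact: beta1.
move=> x; rewrite convX_counit /= !convl_beta beta_op4.
exact: counit_convl.
Qed.

End PositiveRoot.

Theorem corollary8p11 (R : realType) (H : circHopfAlgType R[i])
    (phi : {scalar H}) (Sp N : {lrmorphism H -> H}) :
  compact_quantum_group H ->
  normal_integral phi ->
  positive_antipode phi Sp ->
  nakayama_automorphism phi N ->
  exists beta betaV : {scalar H},
    conv_inverse beta betaV /\
    (forall x, Sp x = convl beta (convr betaV x)) /\
    (forall x, antipode (antipode x)
               = convl (convX beta 2) (convr (convX betaV 2) x)) /\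
    (* (i) *)
    (forall x, beta x = beta (Sp x)) /\
    (forall x, betaV x = betaV (Sp x)) /\
    (* (ii) *)
    (forall x, beta x = Num.conj (beta (circ x))) /\
    (* (iii) *)
    selfadjoint phi (convl beta) /\
    selfadjoint phi (convr betaV) /\
    (forall x, convl beta (convr betaV x) = convr betaV (convl beta x)) /\
    (forall D : {pred H}, simple_subcoalgebra D ->
       {in D, forall x, convl beta x \in D} /\
       {in D, forall x, convr betaV x \in D}) /\
    (* (iv) *)
    positive phi (convl beta) /\
    positive phi (convr betaV) /\
    (forall x y, beta (x * y) = beta x * beta y) /\
    beta 1 = 1 /\
    (forall x, convX beta 4 x = modular_function N x).
Proof.
move=> Hcqg phiN SpP NP.
have [form formU] : exists form : {dot H for (@Num.conj R[i])},
    unitary_inner_product (comul : {linear H -> tensor H H}) form.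
  by apply: Hcqg; split; [exact: comulA|exact: counitr].
exact: (positive_root_character (dot_is_inner form) formU phiN SpP NP).
Qed.
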